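(* Let $m \geq 1$ and let $(M,J)$ be a compact almost-complex manifold of real dimension $2m$. Then there exist a positive almost-complex structure $\widetilde{J}$ on $\mathbb{R}^{6m}$ and a smooth embedding $f : M \hookrightarrow \mathbb{R}^{6m}$ that is pseudo-holomorphic from $(M,J)$ to $(\mathbb{R}^{6m}, \widetilde{J})$.
   Context: Manifolds are smooth and without boundary. An almost-complex structure on an even-dimensional smooth manifold $M$ is a smooth tensor $J \in \mathrm{End}(TM)$ with $J^2 = -\mathrm{id}$; no integrability is required. If $M$ is oriented, $J$ is called positive if the orientation induced by $J$ on $M$ agrees with the given one; $\mathbb{R}^{6m}$ carries its standard orientation. A smooth map $f : N \to M$ between almost-complex manifolds $(N,J')$ and $(M,J)$ is pseudo-holomorphic if $J \circ Tf = Tf \circ J'$, where $Tf : TN \to TM$ is the tangent map of $f$. *)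

(* Defs.v *)
From mathcomp Require Import all_boot all_order all_algebra.
From mathcomp Require Import all_classical all_reals all_analysis.

Set Implicit Arguments.
Unset Strict Implicit.
Unset Printing Implicit Defensive.

Import Order.TTheory GRing.Theory Num.Theory.
Import numFieldNormedType.Exports.

Local Open Scope classical_set_scope.
Local Open Scope ring_scope.

(* Class C^k on an open set U of R^n: all iterated directional derivatives, in
   fixed directions, of order at most k exist and are continuous on U.  It is
   only meant for open U, since derivatives are those of the ambient R^n. *)
Fixpoint Ck_on (R : realType) (n : nat) (W : normedModType R) (k : nat)
    (U : set 'rV[R]_n) (f : 'rV[R]_n -> W) : Prop :=
  match k with
  | 0%N => forall x, U x -> {for x, continuous f}
  | k'.+1 => (forall x, U x -> differentiable f x) /\
             (forall v, Ck_on k' U (fun x => 'D_v f x))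
  end.

Definition smooth_on (R : realType) (n : nat) (W : normedModType R)
    (U : set 'rV[R]_n) (f : 'rV[R]_n -> W) : Prop :=
  forall k, Ck_on k U f.

(* A homeomorphism between open sets [cdom] and [ccod]; the two total functions
   are unconstrained outside of them. *)
Record chart (R : realType) (n : nat) (M : topologicalType) := Chart {
  cdom : set M;
  ccod : set 'rV[R]_n;
  cmap : M -> 'rV[R]_n;
  cinv : 'rV[R]_n -> M;
  cdom_open : open cdom;
  ccod_open : open ccod;
  cmap_ccod : forall p, cdom p -> ccod (cmap p);
  cinv_cdom : forall x, ccod x -> cdom (cinv x);
  cmapK : forall p, cdom p -> cinv (cmap p) = p;
  cinvK : forall x, ccod x -> cmap (cinv x) = x;
  cmap_continuous : forall p, cdom p -> {for p, continuous cmap};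
  cinv_continuous : forall x, ccod x -> {for x, continuous cinv} }.

Definition coord_dom (R : realType) (n k : nat) (N M : topologicalType)
    (c : chart R n N) (d : chart R k M) (f : N -> M) : set 'rV[R]_n :=
  ccod c `&` [set x | cdom d (f (cinv c x))].

Definition coord_rep (R : realType) (n k : nat) (N M : topologicalType)
    (c : chart R n N) (d : chart R k M) (f : N -> M) : 'rV[R]_n -> 'rV[R]_k :=
  fun x => cmap d (f (cinv c x)).

(* The smooth structure is given by an atlas, not required to be maximal: the
   notions below do not depend on the atlas within its equivalence class. *)
Record smoothManifold (R : realType) (n : nat) := SmoothManifold {
  msort :> topologicalType;
  mindex : Type;
  mchart : mindex -> chart R n msort;
  mhausdorff : hausdorff_space msort;
  msecond_countable : @second_countable msort;
  mcover : forall p, exists i, cdom (mchart i) p;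
  mtransition : forall i j, smooth_on (coord_dom (mchart i) (mchart j) id)
                              (coord_rep (mchart i) (mchart j) id) }.

Definition smooth_map (R : realType) (n k : nat) (N : smoothManifold R n)
    (M : smoothManifold R k) (f : N -> M) : Prop :=
  continuous f /\
  forall i j, smooth_on (coord_dom (mchart i) (mchart j) f)
                (coord_rep (mchart i) (mchart j) f).

(* The tangent map of f at p, read in the i-th chart at p and the j-th chart at
   f p.  A tangent vector at p is represented in the i-th chart by a row vector,
   and [tangent_map i j id p] is the change of coordinates in the tangent
   space at p. *)
Definition tangent_map (R : realType) (n k : nat) (N : smoothManifold R n)
    (M : smoothManifold R k) (i : mindex N) (j : mindex M) (f : N -> M) (p : N)
    : 'rV[R]_n -> 'rV[R]_k :=
  'd (coord_rep (mchart i) (mchart j) f) (cmap (mchart i) p).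

(* A smooth section J of End(TM) with J^2 = -id, given by its matrices
   [acs i p] in the charts around p, which act on row vectors by v |-> v *m A;
   [acs_tensor] says that they represent the same endomorphism of T_pM. *)
Record almostComplex (R : realType) (n : nat) (M : smoothManifold R n) :=
  AlmostComplex {
  acs :> mindex M -> M -> 'M[R]_n;
  acs_smooth : forall i,
    smooth_on (ccod (mchart i)) (fun x => acs i (cinv (mchart i) x));
  acs_tensor : forall i j p, cdom (mchart i) p -> cdom (mchart j) p ->
    forall v, tangent_map i j (id : M -> M) p (v *m acs i p) =
              tangent_map i j (id : M -> M) p v *m acs j p;
  acs_sqr : forall i p, cdom (mchart i) p -> acs i p *m acs i p = - 1%:M }.

(* [ori i p] tells whether the coordinate frame of the i-th chart is a positive
   basis of T_pM. *)
Record orientation (R : realType) (n : nat) (M : smoothManifold R n) :=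
  Orientation {
  ori :> mindex M -> M -> bool;
  ori_locally_constant : forall i p, cdom (mchart i) p ->
    \forall q \near p, ori i q = ori i p;
  ori_compatible : forall i j p, cdom (mchart i) p -> cdom (mchart j) p ->
    ori j p =
    ori i p (+) (\det (lin1_mx (tangent_map i j (id : M -> M) p)) < 0) }.

(* The orientation induced by J is the one for which every basis of the form
   (v_0, J v_0, v_1, J v_1, ...) is positive. *)
Definition positive_acs (R : realType) (n : nat) (M : smoothManifold R n)
    (o : orientation M) (J : almostComplex M) : Prop :=
  forall i p, cdom (mchart i) p -> forall v : nat -> 'rV[R]_n,
  let B : 'M[R]_n :=
    \matrix_(k < n) (if odd k then v k./2 *m J i p else v k./2) in
  B \in unitmx -> (0 < \det B) = o i p.

Definition pseudo_holomorphic (R : realType) (n k : nat)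
    (N : smoothManifold R n) (M : smoothManifold R k)
    (J' : almostComplex N) (J : almostComplex M) (f : N -> M) : Prop :=
  smooth_map f /\
  forall i j p, cdom (mchart i) p -> cdom (mchart j) (f p) ->
  forall v, tangent_map i j f p v *m J j (f p) =
            tangent_map i j f p (v *m J' i p).

Definition immersion (R : realType) (n k : nat) (N : smoothManifold R n)
    (M : smoothManifold R k) (f : N -> M) : Prop :=
  smooth_map f /\
  forall i j p, cdom (mchart i) p -> cdom (mchart j) (f p) ->
  injective (tangent_map i j f p).

Definition topological_embedding (N M : topologicalType) (f : N -> M) : Prop :=
  [/\ continuous f, injective f &
      forall U, open U -> exists2 V, open V & f @` U = V `&` range f].

Definition smooth_embedding (R : realType) (n k : nat) (N : smoothManifold R n)
    (M : smoothManifold R k) (f : N -> M) : Prop :=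
  immersion f /\ topological_embedding f.

Section Euclidean.
Variables (R : realType) (n : nat).

Lemma Ck_on_cst (W : normedModType R) k (U : set 'rV[R]_n) (a : W) :
  Ck_on k U (fun=> a).
Proof.
elim: k a => [|k IH] a /=; first by move=> x _; exact: cst_continuous.
split=> [x _|v]; first exact: differentiable_cst.
suff -> : (fun x => 'D_v (fun=> a) x) = (fun=> 0 : W) by exact: IH.
by apply/funext => x; exact: derive_cst.
Qed.

Lemma smooth_on_id (U : set 'rV[R]_n) : smooth_on U (id : 'rV[R]_n -> 'rV[R]_n).
Proof.
case=> [|k] /=; first by move=> x _; exact: (@cvg_id _ (nbhs x)).
split=> [x _|v]; first exact: ex_diff.
suff -> : (fun x => 'D_v id x) = (fun=> v) by exact: Ck_on_cst.
by apply/funext => x; exact: derive_id.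
Qed.

Lemma rV_second_countable : @second_countable 'rV[R]_n.
Proof.
pose c (q : 'rV[rat]_n) : 'rV[R]_n := map_mx ratr q.
pose e (k : nat) : R := k.+1%:R^-1.
exists (range (fun qk : ('rV[rat]_n * nat)%type => ball (c qk.1) (e qk.2))).
  by apply: (card_le_trans (card_image_le _ _)); exact: countableP.
split=> [_ [[q k] _ <-]|x A /=].
  exact: ball_open.
rewrite nbhs_ballP => -[r /= r0 xrA].
have [k kr] : exists k, e k + e k <= r.
  have [k _ hk] := @nbhs_infty_gtr R (2 / r).
  exists k; have {}hk := hk k (leqnn k).
  rewrite /e -div1r -mulrDl ler_pdivrMr ?ltr0n// mulrC -ler_pdivrMr//.
  apply: ltW; apply: (lt_le_trans hk).
  by rewrite ler_nat.
have e0 : 0 < e k by rewrite invr_gt0 ltr0n.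
have [q xq] : exists q, ball x (e k) (c q).
  have /choice[g hg] : forall j : 'I_n, exists q : rat, ball (x ord0 j) (e k) (ratr q).
    move=> j.
    have : x ord0 j - e k < x ord0 j + e k by rewrite ltrD2l gtrN.
    move=> /rat_in_itvoo[q]; rewrite in_itv /= => /andP[h1 h2].
    by exists q; rewrite /ball /= ltr_distlC h1 h2.
  exists (\row_j g j); split=> // i j.
  by rewrite !mxE ord1; exact: hg.
exists (ball (c q) (e k)); last first.
  move=> y /= qy; apply: xrA; apply: (le_ball kr).
  exact: (ball_triangle xq qy).
split; first by exists (q, k).
exact: ball_sym.
Qed.

Definition id_chart : chart R n 'rV[R]_n :=
  @Chart R n 'rV[R]_n setT setT id id openT openT (fun _ _ => I) (fun _ _ => I)
    (fun _ _ => erefl) (fun _ _ => erefl)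
    (fun p _ => @cvg_id _ (nbhs p)) (fun p _ => @cvg_id _ (nbhs p)).

Definition euclidean : smoothManifold R n :=
  @SmoothManifold R n 'rV[R]_n unit (fun=> id_chart) (@norm_hausdorff R _)
    rV_second_countable (fun=> ex_intro _ tt I) (fun _ _ => @smooth_on_id _).

Lemma standard_orientation_compatible (i j : mindex euclidean)
    (p : euclidean) :
  true = true (+) (\det (lin1_mx
    (tangent_map i j (id : euclidean -> euclidean) p)) < 0).
Proof.
rewrite /tangent_map [lin1_mx _](_ : _ = 1%:M).
  by rewrite det1 ltr10.
apply/row_matrixP => k; apply/rowP => l; rewrite !mxE /coord_rep /=.
have -> : 'd (fun x : 'rV[R]_n => x) p = id :> (_ -> _) by exact: diff_val.
by rewrite mxE eqxx eq_sym.
Qed.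

Definition standard_orientation : orientation euclidean :=
  @Orientation R n euclidean (fun _ _ => true)
    (fun _ p _ => @nearW _ (nbhs p) _ _ (fun=> erefl))
    (fun i j p _ _ => standard_orientation_compatible i j p).

End Euclidean.

(* Main.v *)
From HB Require Import structures.
Require Import Defs.
From mathcomp Require Import all_boot all_order all_algebra.
From mathcomp Require Import all_classical all_reals all_analysis.
From mathcomp Require Import complex.
From mathcomp Require Import ring lra zify.

(** Write R^(6m) as C^K with K = 3m, let n = 2m, and for a smooth map
    f : M -> C^K consider, at each point p of M and for each real t, the linear
    map T_pM -> C^K

      f_t (v) = df (v) - t i df (J v).

    Then f_0 = df, while f_1 is complex linear for J.  If f is an injective map
    for which every f_t is injective, then f is already the embedding that is
    wanted.  Indeed, with A_t a smooth left inverse of f_t, the linear map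
    1 - c i df J A_t of C^K carries f_t to f_(t + c), and it is as close to the
    identity as one likes when c is small, uniformly in t in [0, 1] and in p, by
    compactness.  Composing finitely many of these maps carries f_0 to f_1.  A
    map from M to matrices of small norm extends along the embedding f to a map
    from C^K to matrices of small norm, because balls are convex; so the
    composite extends to a smooth map P from C^K to matrices of positive
    determinant.  The conjugate of the standard complex structure by P is an
    almost-complex structure of C^K: it is positive because P has positive
    determinant, and f is pseudo-holomorphic for it because P carries df to the
    complex linear map f_1 ([twist_exists], [emb_pseudo_holomorphic]).

    It remains to find f ([generic_pair_exists]).  Bump functions embed M into
    some R^L ([embedding_exists]); seen as a map to C^L it has the required
    property, since df (v) is then the real part of f_t (v).  The dimension is
    lowered by one by projecting C^(1 + K) to C^K along the complex line spanned
    by (1, u).  The projection fails to be injective or to satisfy the condition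
    on f_t only if u is the slope of some secant f (p) - f (q) or of some vector
    f_t (v).  These slopes are covered by the images of smooth maps from open
    sets of R^(2n) and of R^(2n + 1) to C^K, which are meager when
    2n + 1 < 2K ([meager_smooth_image]), so that a good u exists as long as
    n < K ([generic_pair_project]).  Since 2m < 3m, one can go down to K = 3m.

    Vectors are rows and matrices act on the right.  A map to C^K is given by its
    real and imaginary parts, and the two are interleaved at the very end, to
    agree with the orientation of R^(2K) by bases v_0, J v_0, v_1, J v_1, ... *)

Set Implicit Arguments.
Unset Strict Implicit.
Unset Printing Implicit Defensive.

Import Order.TTheory GRing.Theory Num.Theory.
Import numFieldNormedType.Exports.

Local Open Scope classical_set_scope.
Local Open Scope ring_scope.

(** * Induction on compact sets *)

(** The sets whose complement in [A] satisfies [P] form a filter; if [P] failed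
    for [A] this filter would be proper, and a cluster point of it would
    contradict the local validity of [P]. *)
Lemma compact_ind (T : topologicalType) (P : set T -> Prop) (A : set T) :
  P set0 -> (forall B C, B `<=` C -> P C -> P B) ->
  (forall B C, P B -> P C -> P (B `|` C)) ->
  compact A -> (forall x, A x -> exists2 U, nbhs x U & P U) -> P A.
Proof.
move=> P0 Psub PU cA locP; apply: contrapT => nPA.
pose F : set_system T := [set B | P (A `\` B)].
have FF : Filter F.
  split.
  - by rewrite /F /= setDT.
  - move=> B C PB PC; rewrite /F /=; change (P (A `\` (B `&` C))).
    by rewrite setDIr; exact: PU.
  - by move=> B C BC; apply: Psub; exact: setDS.
have PF : ProperFilter F by split=> //; rewrite /F /= setD0.
have [|x [Ax clx]] := cA F PF; first by rewrite /F /= setDv.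
have [U xU PUU] := locP x Ax.
have [|y [ny]] := clx (~` U) U _ xU; last by [].
by rewrite /F /=; apply: Psub PUU; rewrite setDE setCK; exact: subIsetr.
Qed.

(** * Differentiability, and matrix-valued functions *)

Section Differentiable.
Variables (R : realType) (V W : normedModType R).

Lemma is_diff_approx (f : V -> W) (L : {linear V -> W}) (x : V) :
  continuous L ->
  (forall e, 0 < e -> \forall h \near 0, `|f (h + x) - f x - L h| <= e * `|h|) ->
  is_diff x f L.
Proof.
move=> cL fL.
have E : f \o shift x = cst (f x) + L +o_ 0 id.
  apply/eqaddoP => e e0; apply: filterS (fL e e0) => h.
  by rewrite !fctE /= opprD addrA.
have dE := diff_unique cL E.
by apply: DiffDef => //; apply/diff_locallyP; rewrite dE.
Qed.

Lemma diff_approx (f : V -> W) x : differentiable f x ->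
  forall e, 0 < e ->
  \forall h \near 0, `|f (h + x) - f x - 'd f x h| <= e * `|h|.
Proof.
move=> /diff_locallyP[_ /eqaddoP fE] e e0; apply: filterS (fE e e0) => h.
by rewrite !fctE /= opprD addrA.
Qed.

Lemma near_shift0 (P : V -> Prop) x :
  (\forall y \near x, P y) -> \forall h \near 0, P (h + x).
Proof.
have : shift x @ (0 : V) --> x.
  rewrite -[X in _ --> X]add0r /shift.
  by apply: cvgD; [exact: cvg_id|exact: cvg_cst].
by move=> h Px; exact: h _ Px.
Qed.

Lemma near_eq_is_diff (f g : V -> W) x : (\forall y \near x, f y = g y) ->
  differentiable f x -> is_diff x g ('d f x).
Proof.
move=> fg df; apply: is_diff_approx; first exact: diff_continuous.
move=> e e0; have := diff_approx df e0.
have fgx : f x = g x by exact: nbhs_singleton fg.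
have : \forall h \near (0 : V), f (h + x) = g (h + x).
  exact: near_shift0 fg.
apply: filterS2 => h fgh; by rewrite -fgh -fgx.
Qed.
End Differentiable.

Section Matrices.
Variable R : realType.

Lemma mx_norm_entry p q (A : 'M[R]_(p, q)) i j : `|A i j| <= `|A|.
Proof.
rewrite [leRHS]/Num.Def.normr /= mx_normrE.
exact: (le_bigmax _ (fun ij : 'I_p * 'I_q => `|A ij.1 ij.2|) (i, j)).
Qed.

Lemma mx_norm_leP p q (A : 'M[R]_(p, q)) e : 0 <= e ->
  (forall i j, `|A i j| <= e) -> `|A| <= e.
Proof.
move=> e0 Ae; rewrite [leLHS]/Num.Def.normr /= mx_normrE.
by apply: bigmax_le => // -[i j] _; exact: Ae.
Qed.

Lemma mx_linear_sum p q (W : lmodType R) (L : {linear 'M[R]_(p, q) -> W}) A :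
  L A = \sum_i \sum_j A i j *: L (delta_mx i j).
Proof.
rewrite {1}[A]matrix_sum_delta linear_sum; apply: eq_bigr => i _.
by rewrite linear_sum; apply: eq_bigr => j _; rewrite linearZ.
Qed.

Lemma linear_mx_bounded p q (W : normedModType R)
    (L : {linear 'M[R]_(p, q) -> W}) :
  exists2 C, 0 < C & forall A, `|L A| <= C * `|A|.
Proof.
exists (1 + \sum_i \sum_j `|L (delta_mx i j)|) => [|A].
  by rewrite ltr_pwDl// sumr_ge0// => i _; rewrite sumr_ge0.
rewrite mx_linear_sum mulrDl mul1r.
apply: (@le_trans _ _ ((\sum_i \sum_j `|L (delta_mx i j)|) * `|A|)); last first.
  by rewrite lerDr.
rewrite mulr_suml (le_trans (ler_norm_sum _ _ _))// ler_sum// => i _.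
rewrite mulr_suml (le_trans (ler_norm_sum _ _ _))// ler_sum// => j _.
by rewrite normrZ mulrC ler_wpM2l// mx_norm_entry.
Qed.

Lemma linear_mx_continuous p q (W : normedModType R)
  (L : {linear 'M[R]_(p, q) -> W}) : continuous L.
Proof.
have [C C0 LC] := linear_mx_bounded L.
apply/linear_bounded_continuous/bounded_funP => r; exists (C * r) => x xr.
by rewrite (le_trans (LC x))// ler_wpM2l// ltW.
Qed.

Lemma mx_continuousP (T : topologicalType) p q (F : T -> 'M[R]_(p, q)) x :
  {for x, continuous F} <-> forall i j, {for x, continuous (fun y => F y i j)}.
Proof.
split=> [cF i j|cF].
  by apply: (@continuous_comp _ _ _ F (fun A : 'M[R]_(p, q) => A i j)) => //;
    exact: coord_continuous.
apply/cvgrPdist_le => e e0.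
have : \forall y \near x, forall ij : 'I_p * 'I_q,
    `|F x ij.1 ij.2 - F y ij.1 ij.2| <= e.
  apply: filter_forall => ij.
  by move: e e0; exact/cvgrPdist_le/cF.
apply: filterS => y Fy; apply: mx_norm_leP => [|i j]; first exact: ltW.
by rewrite !mxE; exact: (Fy (i, j)).
Qed.

Lemma mx_differentiableP (V : normedModType R) p q (F : V -> 'M[R]_(p, q)) x :
  differentiable F x <-> forall i j, differentiable (fun y => F y i j) x.
Proof.
split=> [dF i j|dF].
  exact: (@differentiable_comp _ _ _ _ F (fun A : 'M[R]_(p, q) => A i j)
     x dF (differentiable_coord _ _ _)).
have -> : F = \sum_i \sum_j (fun y => F y i j *: delta_mx i j).
  apply/funext => y; rewrite fct_sumE {1}[F y]matrix_sum_delta.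
  by apply: eq_bigr => i _; rewrite fct_sumE.
apply: differentiable_sum => i; apply: differentiable_sum => j.
exact: differentiableZl.
Qed.

Lemma derive_mx_entry (V : normedModType R) p q (F : V -> 'M[R]_(p, q)) x v i j :
  differentiable F x -> ('D_v F x) i j = 'D_v (fun y => F y i j) x.
Proof. by move=> dF; rewrite derive_mx ?mxE//; exact: diff_derivable. Qed.
End Matrices.

(** * Classes C^k and smooth functions on open sets *)

Section CkOn.
Variables (R : realType) (n : nat).
Implicit Types (U V : set 'rV[R]_n) (W : normedModType R) (k : nat).

Lemma Ck_on_sub W k U V (f : 'rV[R]_n -> W) :
  U `<=` V -> Ck_on k V f -> Ck_on k U f.
Proof.
move=> UV; elim: k f => [|k IH] f /=; first by move=> h x /UV /h.
by move=> [df Df]; split=> [x /UV /df //|v]; exact: IH.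
Qed.

Lemma Ck_on_local W k U (f : 'rV[R]_n -> W) :
  (forall x, U x -> exists2 V, V x & Ck_on k V f) -> Ck_on k U f.
Proof.
elim: k f => [|k IH] f /= h.
  by move=> x /h[V Vx]; exact.
split=> [x /h[V Vx [+ _]]|v]; first exact.
by apply: IH => x /h[V Vx [_ +]]; exists V.
Qed.

Lemma open_eq_near (T : Type) U (f g : 'rV[R]_n -> T) x :
  open U -> {in U, f =1 g} -> U x -> \forall y \near x, f y = g y.
Proof.
move=> oU fg Ux; have : \forall y \near x, U y by exact: open_nbhs_nbhs.
by apply: filterS => y Uy; apply: fg; rewrite inE.
Qed.

Lemma Ck_on_eq W k U (f g : 'rV[R]_n -> W) :
  open U -> {in U, f =1 g} -> Ck_on k U f -> Ck_on k U g.
Proof.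
move=> oU; elim: k f g => [|k IH] f g fg /=.
  move=> cf x Ux; have fgx := open_eq_near oU fg Ux.
  rewrite /prop_for /continuous_at -(nbhs_singleton fgx).
  apply: cvg_trans (cf x Ux).
  exact: near_eq_cvg fgx.
move=> [df Df]; split=> [x Ux|v].
  by have [] := near_eq_is_diff (open_eq_near oU fg Ux) (df x Ux).
apply: IH (Df v) => x /set_mem Ux.
exact/near_eq_derive/(open_eq_near oU fg Ux).
Qed.

Lemma Ck_onW W k U (f : 'rV[R]_n -> W) : Ck_on k.+1 U f -> Ck_on k U f.
Proof.
elim: k f => [|k IH] f /=.
  by move=> [df _] x Ux; exact/differentiable_continuous/df.
by move=> [df Df]; split=> // v; exact/IH/Df.
Qed.

Lemma Ck_on_mxP k U p q (F : 'rV[R]_n -> 'M[R]_(p, q)) : open U ->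
  Ck_on k U F <-> forall i j, Ck_on k U (fun x => F x i j : R).
Proof.
move=> oU; elim: k F => [|k IH] F /=.
  split=> [cF i j x Ux|cF x Ux]; first exact: (mx_continuousP _ _).1 (cF x Ux) i j.
  by apply/mx_continuousP => i j; exact: cF.
have E v i j : (forall x, U x -> differentiable F x) ->
    {in U, (fun x => ('D_v F x) i j) =1 (fun x => 'D_v (fun y => F y i j) x)}.
  by move=> dF x /set_mem Ux; rewrite derive_mx_entry//; exact: dF.
split=> [[dF DF] i j|h].
  split=> [x Ux|v]; first exact: (mx_differentiableP _ _).1 (dF x Ux) i j.
  by apply: Ck_on_eq (E v i j dF) _ => //; exact: (IH _).1.
have dF x : U x -> differentiable F x.
  by move=> Ux; apply/mx_differentiableP => i j; have [/(_ x Ux)] := h i j.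
split=> // v; apply/IH => i j; have [_ /(_ v)] := h i j.
by apply: Ck_on_eq => // x xU; rewrite E.
Qed.

Lemma Ck_onD W k U (f g : 'rV[R]_n -> W) : open U ->
  Ck_on k U f -> Ck_on k U g -> Ck_on k U (fun x => f x + g x).
Proof.
move=> oU; elim: k f g => [|k IH] f g /=.
  by move=> cf cg x Ux; apply: continuousD; [exact: cf|exact: cg].
move=> [df Df] [dg Dg]; split=> [x Ux|v].
  by apply: differentiableD; [exact: df|exact: dg].
apply: Ck_on_eq (IH _ _ (Df v) (Dg v)) => // x /set_mem Ux.
by rewrite deriveD//; apply: diff_derivable; [exact: df|exact: dg].
Qed.

Lemma Ck_on_sum W k U (I : Type) (r : seq I) (f : I -> 'rV[R]_n -> W) :
  open U -> (forall i, Ck_on k U (f i)) ->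
  Ck_on k U (fun x => \sum_(i <- r) f i x).
Proof.
move=> oU cf; elim: r => [|i r IH].
  by under eq_fun do rewrite big_nil; exact: Ck_on_cst.
by under eq_fun do rewrite big_cons; exact: Ck_onD.
Qed.

Lemma Ck_onM k U (f g : 'rV[R]_n -> R) : open U ->
  Ck_on k U f -> Ck_on k U g -> Ck_on k U (fun x => f x * g x).
Proof.
move=> oU; elim: k f g => [|k IH] f g.
  by move=> /= cf cg x Ux; apply: continuousM; [exact: cf|exact: cg].
move=> fk gk; have [df Df] := fk; have [dg Dg] := gk; split=> [x Ux|v].
  by apply: differentiableM; [exact: df|exact: dg].
have h := Ck_onD oU (IH _ _ (Ck_onW fk) (Dg v)) (IH _ _ (Ck_onW gk) (Df v)).
apply: Ck_on_eq h => // x /set_mem Ux /=.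
by rewrite -deriveM//; apply: diff_derivable; [exact: df|exact: dg].
Qed.

Lemma Ck_on_prod k U (I : Type) (r : seq I) (f : I -> 'rV[R]_n -> R) :
  open U -> (forall i, Ck_on k U (f i)) ->
  Ck_on k U (fun x => \prod_(i <- r) f i x).
Proof.
move=> oU cf; elim: r => [|i r IH].
  by under eq_fun do rewrite big_nil; exact: Ck_on_cst.
by under eq_fun do rewrite big_cons; exact: Ck_onM.
Qed.

Lemma Ck_onV k U (f : 'rV[R]_n -> R) : open U ->
  (forall x, U x -> f x != 0) ->
  Ck_on k U f -> Ck_on k U (fun x => (f x)^-1).
Proof.
move=> oU f0; elim: k => [|k IH].
  by move=> /= cf x Ux; apply: continuousV; [exact: f0|exact: cf].
move=> fk; have [df Df] := fk; split=> [x Ux|v].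
  by apply: differentiableV; [exact: df|exact: f0].
have Vk := IH (Ck_onW fk).
have h := Ck_onM oU (@Ck_on_cst R n R k U (-1)) (Ck_onM oU (Ck_onM oU Vk Vk) (Df v)).
apply: Ck_on_eq h => // x /set_mem Ux /=.
have dfx : derivable f x v := diff_derivable (df x Ux).
by rewrite [RHS](@deriveV _ _ f)// ?f0// mulN1r scaleNr expr2 invfM.
Qed.

End CkOn.

(** The partial derivatives of [g] occur composed with [f] in the derivative of
    [g \o f], so that the induction on [k] has to range over all [g]. *)
Lemma Ck_on_comp (R : realType) n m k (U : set 'rV[R]_n)
    (V : set 'rV[R]_m) (f : 'rV[R]_n -> 'rV[R]_m) (g : 'rV[R]_m -> R) :
  open U -> U `<=` f @^-1` V -> Ck_on k U f -> Ck_on k V g ->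
  Ck_on k U (g \o f).
Proof.
move=> oU UV; elim: k g => [|k IH] g.
  move=> /= cf cg x Ux; apply: continuous_comp; first exact: cf.
  by apply: cg; exact: UV.
move=> fk gk; have [df Df] := fk; have [dg Dg] := gk; split=> [x Ux|v].
  by apply: differentiable_comp; [exact: df|apply: dg; exact: UV].
have h : Ck_on k U (fun x => \sum_j 'D_v f x ord0 j * ('D_(delta_mx ord0 j) g \o f) x).
  apply: Ck_on_sum => // j; apply: Ck_onM => //.
    exact: (Ck_on_mxP _ _ oU).1 (Df v) ord0 j.
  exact: IH (Ck_onW fk) (Dg _).
apply: Ck_on_eq h => // x /set_mem Ux /=.
have dfx := df x Ux; have dgx : differentiable g (f x) by apply: dg; exact: UV.
rewrite [RHS]deriveE; last exact: differentiable_comp.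
rewrite diff_comp//= -(deriveE v dfx) (mx_linear_sum ('d g (f x))) big_ord1.
by apply: eq_bigr => j _; rewrite (deriveE _ dgx).
Qed.

Section SmoothOn.
Variables (R : realType) (n : nat).
Implicit Types (U V : set 'rV[R]_n) (W : normedModType R).

Lemma smooth_on_sub W U V (f : 'rV[R]_n -> W) :
  U `<=` V -> smooth_on V f -> smooth_on U f.
Proof. by move=> UV sf k; exact: Ck_on_sub UV (sf k). Qed.

Lemma smooth_on_local W U (f : 'rV[R]_n -> W) :
  (forall x, U x -> exists2 V, V x & smooth_on V f) -> smooth_on U f.
Proof.
move=> h k; apply: Ck_on_local => x /h[V Vx sV]; exists V => //; exact: sV.
Qed.

Lemma smooth_on_eq W U (f g : 'rV[R]_n -> W) :
  open U -> {in U, f =1 g} -> smooth_on U f -> smooth_on U g.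
Proof. by move=> oU fg sf k; exact: Ck_on_eq (sf k). Qed.

Lemma smooth_on_cst W U (a : W) : smooth_on U (fun=> a).
Proof. by move=> k; exact: Ck_on_cst. Qed.

Lemma smooth_on_mxP U p q (F : 'rV[R]_n -> 'M[R]_(p, q)) : open U ->
  smooth_on U F <-> forall i j, smooth_on U (fun x => F x i j : R).
Proof.
move=> oU; split=> [sF i j k|h k].
  exact: (Ck_on_mxP k F oU).1 (sF k) i j.
by apply/Ck_on_mxP => // i j; exact: h.
Qed.

Lemma smooth_on_differentiable W U (f : 'rV[R]_n -> W) x :
  smooth_on U f -> U x -> differentiable f x.
Proof. by move=> /(_ 1%N)[df _]; exact: df. Qed.

Lemma smooth_on_continuous W U (f : 'rV[R]_n -> W) x :
  smooth_on U f -> U x -> {for x, continuous f}.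
Proof. by move=> /(_ 0%N); exact. Qed.

Lemma smooth_on_derive W U (f : 'rV[R]_n -> W) v :
  smooth_on U f -> smooth_on U (fun x => 'D_v f x).
Proof. by move=> sf k; have [_ +] := sf k.+1; exact. Qed.

Variable U : set 'rV[R]_n.
Hypothesis oU : open U.

Lemma smooth_onD W (f g : 'rV[R]_n -> W) :
  smooth_on U f -> smooth_on U g -> smooth_on U (fun x => f x + g x).
Proof. by move=> sf sg k; exact: Ck_onD (sf k) (sg k). Qed.

Lemma smooth_onM (f g : 'rV[R]_n -> R) :
  smooth_on U f -> smooth_on U g -> smooth_on U (fun x => f x * g x).
Proof. by move=> sf sg k; exact: Ck_onM (sf k) (sg k). Qed.

Lemma smooth_on_sum W (I : Type) (r : seq I) (f : I -> 'rV[R]_n -> W) :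
  (forall i, smooth_on U (f i)) -> smooth_on U (fun x => \sum_(i <- r) f i x).
Proof. by move=> sf k; apply: Ck_on_sum => // i; exact: sf. Qed.

Lemma smooth_on_prod (I : Type) (r : seq I) (f : I -> 'rV[R]_n -> R) :
  (forall i, smooth_on U (f i)) -> smooth_on U (fun x => \prod_(i <- r) f i x).
Proof. by move=> sf k; apply: Ck_on_prod => // i; exact: sf. Qed.

Lemma smooth_onV (f : 'rV[R]_n -> R) : (forall x, U x -> f x != 0) ->
  smooth_on U f -> smooth_on U (fun x => (f x)^-1).
Proof. by move=> f0 sf k; apply: Ck_onV => //; exact: sf. Qed.

Lemma smooth_onN (f : 'rV[R]_n -> R) :
  smooth_on U f -> smooth_on U (fun x => - f x).
Proof.
move=> sf; have := smooth_onM (smooth_on_cst U (-1 : R)) sf.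
by apply: smooth_on_eq => // x _; rewrite mulN1r.
Qed.

Lemma smooth_onZ p q (a : 'rV[R]_n -> R) (F : 'rV[R]_n -> 'M[R]_(p, q)) :
  smooth_on U a -> smooth_on U F -> smooth_on U (fun x => a x *: F x).
Proof.
move=> sa /(smooth_on_mxP _ oU) sF; apply/smooth_on_mxP => // i j.
by under eq_fun do rewrite mxE; exact: smooth_onM.
Qed.

Lemma smooth_onNmx p q (F : 'rV[R]_n -> 'M[R]_(p, q)) :
  smooth_on U F -> smooth_on U (fun x => - F x).
Proof.
move=> sF; have := smooth_onZ (smooth_on_cst U (-1 : R)) sF.
by apply: smooth_on_eq => // x _; rewrite scaleN1r.
Qed.

Lemma smooth_onB p q (F G : 'rV[R]_n -> 'M[R]_(p, q)) :
  smooth_on U F -> smooth_on U G -> smooth_on U (fun x => F x - G x).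
Proof. by move=> sF sG; apply: smooth_onD => //; exact: smooth_onNmx. Qed.

Lemma smooth_on_mulmx p q r (F : 'rV[R]_n -> 'M[R]_(p, q))
    (G : 'rV[R]_n -> 'M[R]_(q, r)) :
  smooth_on U F -> smooth_on U G -> smooth_on U (fun x => F x *m G x).
Proof.
move=> /(smooth_on_mxP _ oU) sF /(smooth_on_mxP _ oU) sG.
apply/smooth_on_mxP => // i j; under eq_fun do rewrite mxE.
by apply: smooth_on_sum => k; exact: smooth_onM.
Qed.

Lemma smooth_on_trmx p q (F : 'rV[R]_n -> 'M[R]_(p, q)) :
  smooth_on U F -> smooth_on U (fun x => (F x)^T).
Proof.
move=> /(smooth_on_mxP _ oU) sF; apply/smooth_on_mxP => // i j.
by under eq_fun do rewrite mxE; exact: sF.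
Qed.

Lemma smooth_on_row_mx p q r (F : 'rV[R]_n -> 'M[R]_(p, q))
    (G : 'rV[R]_n -> 'M[R]_(p, r)) :
  smooth_on U F -> smooth_on U G -> smooth_on U (fun x => row_mx (F x) (G x)).
Proof.
move=> /(smooth_on_mxP _ oU) sF /(smooth_on_mxP _ oU) sG.
apply/smooth_on_mxP => // i j; under eq_fun do rewrite mxE.
by case: (fintype.split j) => l; [exact: sF|exact: sG].
Qed.

Lemma smooth_on_det p (F : 'rV[R]_n -> 'M[R]_p) :
  smooth_on U F -> smooth_on U (fun x => \det (F x)).
Proof.
move=> /(smooth_on_mxP _ oU) sF.
apply: smooth_on_sum => s; apply: smooth_onM; first exact: smooth_on_cst.
by apply: smooth_on_prod => // i; exact: sF.
Qed.

Lemma smooth_on_invmx p (F : 'rV[R]_n -> 'M[R]_p) :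
  (forall x, U x -> F x \in unitmx) ->
  smooth_on U F -> smooth_on U (fun x => invmx (F x)).
Proof.
move=> uF sF.
have sV : smooth_on U (fun x => (\det (F x))^-1 *: \adj (F x)).
  apply: smooth_onZ.
    apply: smooth_onV; last exact: smooth_on_det.
    by move=> x /uF; rewrite unitmxE unitfE.
  apply/smooth_on_mxP => // i j; under eq_fun do rewrite mxE.
  apply: smooth_onM; first exact: smooth_on_cst.
  apply: smooth_on_det; apply/smooth_on_mxP => // i' j'.
  by under eq_fun do rewrite !mxE; exact: (smooth_on_mxP _ oU).1.
by apply: smooth_on_eq sV => // x /set_mem /uF Fx; rewrite /invmx Fx.
Qed.

Lemma smooth_on_linear p q (L : {linear 'rV[R]_n -> 'M[R]_(p, q)}) :
  smooth_on U L.
Proof.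
apply/smooth_on_mxP => // i j.
under eq_fun do rewrite (mx_linear_sum L) big_ord1 summxE.
apply: smooth_on_sum => k; under eq_fun do rewrite mxE.
apply: smooth_onM; last exact: smooth_on_cst.
by apply: (smooth_on_mxP (id : 'rV[R]_n -> _) oU).1; exact: smooth_on_id.
Qed.

Lemma smooth_on_jacobian m (f : 'rV[R]_n -> 'rV[R]_m) :
  smooth_on U f -> smooth_on U (jacobian f).
Proof.
move=> sf; apply/smooth_on_mxP => // i j.
have := (smooth_on_mxP _ oU).1 (smooth_on_derive (delta_mx ord0 i) sf) ord0 j.
apply: smooth_on_eq => // x /set_mem Ux.
by rewrite deriveE ?mxE//; exact: smooth_on_differentiable sf Ux.
Qed.

End SmoothOn.

Section SmoothComp.
Variables (R : realType) (n m : nat) (U : set 'rV[R]_n) (V : set 'rV[R]_m).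
Variable f : 'rV[R]_n -> 'rV[R]_m.
Hypotheses (oU : open U) (oV : open V) (UV : U `<=` f @^-1` V).
Hypothesis sf : smooth_on U f.

Lemma smooth_on_comp (g : 'rV[R]_m -> R) :
  smooth_on V g -> smooth_on U (g \o f).
Proof. by move=> sg k; exact: Ck_on_comp (sf k) (sg k). Qed.

Lemma smooth_on_comp_mx p q (g : 'rV[R]_m -> 'M[R]_(p, q)) :
  smooth_on V g -> smooth_on U (g \o f).
Proof.
move=> /(smooth_on_mxP _ oV) sg; apply/smooth_on_mxP => // i j.
exact: (@smooth_on_comp (fun x => g x i j)).
Qed.
End SmoothComp.

(** * Bump functions *)

Section Flat.
Variable R : realType.

(** The functions t^-k exp (-1/t) extended by 0, for all [k] at once: their span
    is closed under derivation. *)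
Definition flat (k : nat) (t : R) : R :=
  if 0 < t then t^-1 ^+ k * expR (- t^-1) else 0.

Lemma flat_ge0 k t : 0 <= flat k t.
Proof.
rewrite /flat; case: ifP => // t0.
by rewrite mulr_ge0// ?expR_ge0// exprn_ge0// invr_ge0 ltW.
Qed.

Lemma flat_gt0 t : 0 < t -> 0 < flat 0 t.
Proof. by move=> t0; rewrite /flat t0 expr0 mul1r expR_gt0. Qed.

Lemma flat_le0 k t : t <= 0 -> flat k t = 0.
Proof. by move=> t0; rewrite /flat ltNge t0. Qed.

(** A quadratic bound suffices for differentiability at 0 with derivative 0; it
    comes from exp s = (exp (s / m))^m >= (s / m)^m with s = 1/t, m = k + 2. *)
Lemma flat_quadratic k t : `|flat k t| <= (k.+2 ^ k.+2)%:R * `|t| ^+ 2.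
Proof.
rewrite ger0_norm ?flat_ge0// /flat; case: ifP => [t0|_]; last first.
  by rewrite mulr_ge0// exprn_ge0.
rewrite gtr0_norm//; set C := _%:R; have [s s0 ->] : exists2 s, 0 < s & t = s^-1.
  by exists t^-1; rewrite ?invr_gt0// invrK.
rewrite !invrK expRN.
suff H : s ^+ k.+2 <= C * expR s.
  rewrite ler_pdivrMr ?expR_gt0// mulrAC exprVn ler_pdivlMr ?exprn_gt0//.
  by rewrite -exprD addn2.
have -> : expR s = expR (s / k.+2%:R) ^+ k.+2 by rewrite -expRM_natr divfK.
rewrite /C natrX -exprMn; apply: lerXn2r; rewrite ?nnegrE ?mulr_ge0 ?expR_ge0 1?ltW//.
rewrite mulrC -ltr_pdivrMr//.
by apply: lt_le_trans (expR_ge1Dx _); rewrite ltrDr.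
Qed.

Lemma is_derive_flat k (t : R) :
  is_derive t (1 : R) (flat k) (flat k.+2 t - k%:R * flat k.+1 t).
Proof.
have [t0|t0|->] := ltgtP t 0.
- rewrite !flat_le0 ?ltW// mulr0 subr0.
  apply: (@near_eq_is_derive _ _ _ (cst 0)).
  near=> s; rewrite flat_le0//; near: s.
  exact: lt_le_nbhsl.
- pose g := fun s : R => s^-1.
  have dg : is_derive t (1 : R) g (- t ^- 2).
    have := @is_deriveV R id t 1 1 (lt0r_neq0 t0) (is_derive_id t 1).
    by rewrite scaler1.
  have gt0 : g t = t^-1 by [].
  have dng : is_derive t (1 : R) (fun s => - g s) (t ^- 2).
    by apply: is_derive_eq; rewrite opprK.
  have de : is_derive t (1 : R) (expR \o (fun s => - g s)) (expR (- t^-1) * t ^- 2).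
    exact: is_derive1_comp.
  have dX := is_deriveX k dg.
  apply: (@near_eq_is_derive _ _ _ (g ^+ k * (expR \o (fun s => - g s)))).
    near=> s; rewrite /flat ifT//=.
      by rewrite -[LHS]/((g ^+ k) s * expR (- g s)) exprfctE.
    near: s; exact: lt_nbhsr.
  apply: is_derive_eq.
  rewrite /flat t0 exprfctE /= /GRing.scale /= gt0 -exprVn.
  case: k {dX} => [|k]; rewrite ?expr0 ?exprS /=; ring.
- rewrite !flat_le0// mulr0 subr0.
  have dF : is_diff (0 : R) (flat k) (\0 : {linear R -> R}).
    apply: is_diff_approx; first exact: cst_continuous.
    move=> e e0; pose C : R := (k.+2 ^ k.+2)%:R.
    have C0 : 0 < C by rewrite ltr0n expn_gt0.
    have : \forall h \near (0 : R), `|h| < e / C.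
      by apply: nbhs0_lt; rewrite divr_gt0.
    apply: filterS => h; rewrite addr0 (flat_le0 _ (lexx 0)) subr0 /= subr0 => he.
    rewrite (le_trans (flat_quadratic _ _))// expr2 mulrA ler_wpM2r//.
    by rewrite mulrC -ler_pdivlMr// ltW.
  have dd : derivable (flat k) 0 1 by apply: diff_derivable; exact: ex_diff.
  by apply: DeriveDef => //; rewrite deriveE ?diff_val//; exact: ex_diff.
Unshelve. all: by end_near. Qed.

Lemma Ck_on_flat n j k (U : set 'rV[R]_n) (a : 'rV[R]_n -> R) : open U ->
  Ck_on j U a -> Ck_on j U (fun x => flat k (a x)).
Proof.
move=> oU; have df i (t : R) : differentiable (flat i) t.
  by apply/derivable1_diffP; have [] := is_derive_flat i t.
elim: j k => [|j IH] k.
  move=> /= ca x Ux; apply: (@continuous_comp _ _ _ a (flat k)); first exact: ca.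
  exact/differentiable_continuous/df.
move=> aj; have [da Da] := aj; split=> [x Ux|v].
  by apply: (@differentiable_comp _ _ _ _ a (flat k)); [exact: da|exact: df].
have aj' := Ck_onW aj.
have h := Ck_onM oU (Da v) (Ck_onD oU (IH k.+2 aj')
  (Ck_onM oU (@Ck_on_cst R n R j U (- k%:R)) (IH k.+1 aj'))).
apply: Ck_on_eq h => // x /set_mem Ux.
rewrite [RHS]deriveE; last by apply: (@differentiable_comp _ _ _ _ a (flat k)); [exact: da|exact: df].
rewrite (@diff_comp _ _ _ _ a (flat k)) ?da//=; last exact: da.
rewrite -(deriveE v (da x Ux)) diff1E// derive1E /GRing.scale /=; congr (_ * _).
by have [_ ->] := is_derive_flat k (a x); rewrite mulNr.
Qed.

Definition smoothstep (t : R) : R := flat 0 t / (flat 0 t + flat 0 (1 - t)).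

Lemma smoothstep_den_gt0 t : 0 < flat 0 t + flat 0 (1 - t).
Proof.
have [t0|t0] := ltP 0 t; first by rewrite ltr_pwDl ?flat_gt0// flat_ge0.
by rewrite ltr_wpDl ?flat_ge0// flat_gt0// subr_gt0 (le_lt_trans t0).
Qed.

Lemma smoothstep_itv t : 0 <= smoothstep t <= 1.
Proof.
rewrite divr_ge0 ?flat_ge0 ?(ltW (smoothstep_den_gt0 _))//=.
by rewrite /smoothstep ler_pdivrMr ?smoothstep_den_gt0// mul1r lerDl flat_ge0.
Qed.

Lemma smoothstep_ge1 t : 1 <= t -> smoothstep t = 1.
Proof.
move=> t1; rewrite /smoothstep (@flat_le0 0 (1 - t)) ?subr_le0// addr0 divff//.
by rewrite gt_eqF// flat_gt0// (lt_le_trans ltr01).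
Qed.

Lemma smoothstep_le0 t : t <= 0 -> smoothstep t = 0.
Proof. by move=> t0; rewrite /smoothstep (@flat_le0 0 t)// mul0r. Qed.

Lemma smooth_on_smoothstep n (U : set 'rV[R]_n) (a : 'rV[R]_n -> R) : open U ->
  smooth_on U a -> smooth_on U (fun x => smoothstep (a x)).
Proof.
move=> oU sa; have sf b : smooth_on U b -> smooth_on U (fun x => flat 0 (b x)).
  by move=> sb k; exact: Ck_on_flat (sb k).
apply: smooth_onM => //; first exact: sf.
apply: smooth_onV => //; first by move=> x _; rewrite gt_eqF// smoothstep_den_gt0.
apply: smooth_onD => //; apply: sf => //; apply: smooth_onD => //.
  exact: smooth_on_cst.
exact: smooth_onN.
Qed.

(** The cutoff is applied to 2 - 2 q / e^2, with q the square of the Euclidean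
    distance to [p]: it is 1 where q <= e^2 / 2 and 0 where q >= e^2. *)
Lemma bump_exists n (p : 'rV[R]_n) (e : R) : 0 < e ->
  exists b : 'rV[R]_n -> R,
    [/\ smooth_on setT b, forall x, 0 <= b x <= 1,
        \forall x \near p, b x = 1 & forall x, b x != 0 -> `|x - p| <= e].
Proof.
move=> e0; pose q (x : 'rV[R]_n) := \sum_j (x ord0 j - p ord0 j) ^+ 2.
have q0 x : 0 <= q x by apply: sumr_ge0 => j _; rewrite sqr_ge0.
pose a (x : 'rV[R]_n) := 2 - q x * (2 / e ^+ 2).
have sa : smooth_on setT a.
  apply: smooth_onD => //; first exact: openT; first exact: smooth_on_cst.
  apply: smooth_onN; first exact: openT.
  apply: smooth_onM; [exact: openT| |exact: smooth_on_cst].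
  apply: smooth_on_sum => [|j]; first exact: openT.
  have sj : smooth_on setT (fun x : 'rV[R]_n => x ord0 j - p ord0 j).
    apply: smooth_onD; [exact: openT| |exact: smooth_on_cst].
    by apply: (smooth_on_mxP (id : 'rV[R]_n -> _) openT).1; exact: smooth_on_id.
  by under eq_fun do rewrite expr2; apply: smooth_onM => //; exact: openT.
exists (fun x => smoothstep (a x)); split.
- by apply: smooth_on_smoothstep => //; exact: openT.
- by move=> x; exact: smoothstep_itv.
- have ap : a p = 2.
    by rewrite /a /q big1 ?mul0r ?subr0// => j _; rewrite subrr expr0n.
  have ca : {for p, continuous a} by exact: smooth_on_continuous sa _.
  have : \forall x \near p, 1 < a x.
    by apply: (cvgr_gt (a p) ca); rewrite ap ltr1n.
  by apply: filterS => x /ltW /smoothstep_ge1.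
- move=> x sx; have ax : 0 < a x.
    by rewrite ltNge; apply: contra sx => /smoothstep_le0 ->.
  have {ax} qx : q x < e ^+ 2.
    by move: ax; rewrite /a subr_gt0 mulrA ltr_pdivrMr ?exprn_gt0// mulrC ltr_pM2l.
  apply: mx_norm_leP => [|i j]; first exact: ltW.
  rewrite ord1 !mxE -ler_sqr ?nnegrE ?(ltW e0)// real_normK ?num_real// ltW//.
  apply: le_lt_trans qx; rewrite /q (bigD1 j)//= lerDl.
  by apply: sumr_ge0 => l _; rewrite sqr_ge0.
Qed.
End Flat.

(** * Inverse functions and left inverses of immersions *)

HB.instance Definition _ (R : realType) m n := Complete.on 'M[R]_(m, n).

Section MeanValue.
Variable R : realType.

Lemma norm_mulmx p q r (A : 'M[R]_(p, q)) (B : 'M[R]_(q, r)) :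
  `|A *m B| <= q%:R * `|A| * `|B|.
Proof.
apply: mx_norm_leP => [|i j]; first by rewrite !mulr_ge0.
rewrite mxE (le_trans (ler_norm_sum _ _ _))//.
apply: (@le_trans _ _ (\sum_(k < q) `|A| * `|B|)).
  by apply: ler_sum => k _; rewrite normrM ler_pM// mx_norm_entry.
by rewrite -mulrA mulr_natl sumr_const card_ord.
Qed.

Lemma mean_value_ineq n m (S : set 'rV[R]_n) (F : 'rV[R]_n -> 'rV[R]_m) C :
  0 <= C ->
  (forall x y (t : R), S x -> S y -> 0 <= t <= 1 -> S (x + t *: (y - x))) ->
  (forall x, S x -> differentiable F x) ->
  (forall x v, S x -> `|'d F x v| <= C * `|v|) ->
  forall x y, S x -> S y -> `|F y - F x| <= C * `|y - x|.
Proof.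
move=> C0 cS dF bF x y Sx Sy; set v := y - x.
pose g (t : R) : 'rV[R]_n := x + t *: v.
have dg (t : R) : is_diff t g (fun h => h *: v).
  have := is_diffD (is_diff_cst x t) (is_diff_scalel t v).
  by rewrite add0r.
apply: mx_norm_leP => [|i j]; first by rewrite mulr_ge0.
rewrite ord1 => {i}.
pose phi (t : R) : R := (F (g t)) ord0 j.
have Sg (t : R) : 0 <= t <= 1 -> S (g t) by exact: cS.
have dFg (t : R) : 0 <= t <= 1 -> differentiable (F \o g) t.
  move=> t01; apply: differentiable_comp; first exact: ex_diff.
  by apply: dF; exact: Sg.
have dphi (t : R) : 0 <= t <= 1 -> differentiable phi t.
  move=> t01; exact: (mx_differentiableP (F \o g) t).1 (dFg t t01) ord0 j.
have Dphi (t : R) : 0 <= t <= 1 -> 'D_1 phi t = ('d F (g t) v) ord0 j.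
  move=> t01; rewrite -(@derive_mx_entry _ _ _ _ (F \o g)); last exact: dFg.
  rewrite deriveE; last exact: dFg.
  rewrite diff_comp//=; first by rewrite diff_val scale1r.
  by apply: dF; exact: Sg.
have [] := @MVT_segment R phi (fun t => ('d F (g t) v) ord0 j) 0 1 ler01.
- move=> t /[!in_itv]/= /andP[t0 t1]; have t01 : 0 <= t <= 1 by rewrite !ltW.
  by rewrite -Dphi//; apply: DeriveDef => //; apply: diff_derivable; exact: dphi.
- apply: continuous_in_subspaceT => t /set_mem/= /[!in_itv]/= t01.
  exact/differentiable_continuous/dphi.
move=> t /[!in_itv]/= t01; rewrite subr0 mulr1 /phi /g scale0r addr0 scale1r.
rewrite /v [x + _]addrC subrK !mxE => ->.
by apply: le_trans (mx_norm_entry _ _ _) _; apply: bF; exact: Sg.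
Qed.

Lemma cball_convex n (p : 'rV[R]_n) r x y (t : R) : `|x - p| <= r -> `|y - p| <= r ->
  0 <= t <= 1 -> `|x + t *: (y - x) - p| <= r.
Proof.
move=> xr yr /andP[t0 t1].
have -> : x + t *: (y - x) - p = (1 - t) *: (x - p) + t *: (y - p).
  apply/rowP => j; rewrite !mxE; ring.
apply: le_trans (ler_normD _ _) _; rewrite !normrZ !ger0_norm ?subr_ge0//.
apply: le_trans (lerD (ler_wpM2l _ xr) (ler_wpM2l _ yr)) _; rewrite ?subr_ge0//.
by rewrite -mulrDl subrK mul1r.
Qed.

Lemma closed_cball n (p : 'rV[R]_n) r : closed [set x | `|x - p| <= r].
Proof.
have -> : [set x | `|x - p| <= r] = (fun x => `|x - p|) @^-1` [set t | t <= r] by [].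
apply: preimage_closed; last exact: closed_le.
move=> x _; apply: (@continuous_comp _ _ _ (fun x : 'rV[R]_n => x - p) (fun x : 'rV[R]_n => `|x|)).
  by apply: (@cvgB _ _ _ (nbhs x) _ id (cst p)); [exact: cvg_id|exact: cvg_cst].
exact: norm_continuous.
Qed.

Lemma compact_cball n (p : 'rV[R]_n) r : compact [set x | `|x - p| <= r].
Proof.
apply: bounded_closed_compact; last exact: closed_cball.
exists (r + `|p|); split; first exact: num_real.
move=> t rt x /= xr; rewrite ltW//; apply: le_lt_trans rt.
have -> : x = x - p + p by rewrite subrK.
by rewrite (le_trans (ler_normD _ _))// lerD2r.
Qed.

Lemma nbhs_cball n (p : 'rV[R]_n) (U : set 'rV[R]_n) : nbhs p U ->
  exists2 r, 0 < r & [set x | `|x - p| <= r] `<=` U.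
Proof.
move=> /nbhs_ballP[r /= r0 rU]; exists (r / 2); first by rewrite divr_gt0.
move=> x xr; apply: rU; rewrite -ball_normE /= distrC (le_lt_trans xr)//.
by rewrite ltr_pdivrMr// ltr_pMr// ltr1n.
Qed.

Lemma inj_unitmx n (A : 'M[R]_n) :
  (forall v : 'rV[R]_n, v *m A = 0 -> v = 0) -> A \in unitmx.
Proof.
move=> iA; rewrite -row_free_unit -kermx_eq0; apply/eqP/row_matrixP => i.
by rewrite row0; apply: iA; rewrite -row_mul mulmx_ker row0.
Qed.
End MeanValue.

Section InverseFunction.
Variables (R : realType) (n : nat) (U : set 'rV[R]_n) (H : 'rV[R]_n -> 'rV[R]_n).
Variable x0 : 'rV[R]_n.
Hypotheses (oU : open U) (Ux0 : U x0) (sH : smooth_on U H).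
Hypothesis dH0 : jacobian H x0 = 1%:M.

Let dH x : U x -> differentiable H x.
Proof. by move=> Ux; exact: smooth_on_differentiable sH Ux. Qed.

Lemma inverse_radius : exists2 r, 0 < r & forall x, `|x - x0| <= r ->
  U x /\ forall v : 'rV[R]_n, `|v *m jacobian H x - v| <= 2^-1 * `|v|.
Proof.
have e0 : 0 < (2 * n.+1%:R)^-1 :> R by rewrite invr_gt0 mulr_gt0.
have cJ : {for x0, continuous (jacobian H)}.
  exact: smooth_on_continuous (smooth_on_jacobian oU sH) Ux0.
have : \forall x \near x0, U x /\ `|jacobian H x0 - jacobian H x| < (2 * n.+1%:R)^-1.
  have Ux : \forall x \near x0, U x by exact: open_nbhs_nbhs.
  move/cvgrPdist_lt: cJ => /(_ _ e0).
  by move: Ux; apply: filterS2 => x.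
move=> /nbhs_cball[r r0 hr]; exists r => // x /hr[Ux Jx].
split=> // v; rewrite -{2}[v]mulmx1 -mulmxBr -dH0.
apply: le_trans (norm_mulmx _ _) _; rewrite distrC.
apply: (@le_trans _ _ (n%:R * `|v| * (2 * n.+1%:R)^-1)).
  by rewrite ler_wpM2l ?mulr_ge0// ltW.
rewrite mulrAC ler_wpM2r// ler_pdivrMr ?mulr_gt0// mulKf//.
by rewrite ler_nat.
Qed.

(** For [y] close to [H x0], a solution of [H x = y] is a fixed point of
    x |-> y - (H x - x), a contraction of a ball around [x0] because [H - id] is
    1/2-Lipschitz there.  The inverse [G] is 2-Lipschitz, hence differentiable
    with derivative the inverse matrix of the jacobian of [H] at [G y]; this
    expresses the derivatives of [G] through [G] itself and gives smoothness by
    induction on the order. *)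
Lemma inverse_function : exists U0 V0 G,
  [/\ open U0, U0 x0, U0 `<=` U, open V0 & smooth_on V0 G] /\
  (forall x, U0 x -> V0 (H x) /\ G (H x) = x) /\
  (forall y, V0 y -> U0 (G y)).
Proof.
have [r r0 hr] := inverse_radius.
pose B := [set x : 'rV[R]_n | `|x - x0| <= r].
have BU x : B x -> U x by move=> /hr[].
have dB x : B x -> differentiable H x by move=> /BU; exact: dH.
have dE x v : B x -> 'd H x v = v *m jacobian H x.
  by move=> Bx; rewrite -deriveE ?deriveEjacobian//; exact: dB.
have hlip x y : B x -> B y -> `|(H y - y) - (H x - x)| <= 2^-1 * `|y - x|.
  move=> Bx By.
  have dh z : B z -> is_diff z (fun z => H z - z) (fun v => 'd H z v - v).
    by move=> Bz; have := is_diffB (differentiableP (dB z Bz)) (is_diff_id z).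
  apply: (@mean_value_ineq R n n B (fun z => H z - z) 2^-1 _ _ _ _ x y Bx By).
  - by rewrite invr_ge0.
  - by move=> ? ? ?; exact: cball_convex.
  - by move=> z /dh dz; exact: ex_diff.
  - move=> z v Bz; have dz := dh z Bz; rewrite diff_val dE//.
    by have [_] := hr z Bz; exact.
have Hlip x y : B x -> B y -> `|y - x| <= 2 * `|H y - H x|.
  move=> Bx By; have := hlip x y Bx By.
  have : `|y - x| <= `|H y - H x| + `|(H y - y) - (H x - x)|.
    have {1}-> : y - x = H y - H x - (H y - y - (H x - x)).
      by apply/rowP => j; rewrite !mxE; ring.
    exact: ler_normB.
  lra.
pose V0 := ball (H x0) (r / 2).
have Gex y : exists x, V0 y -> `|x - x0| < r /\ H x = y.
  have [Vy|] := pselect (V0 y); last by exists x0.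
  (* T maps the closed ball into the open one: y is within r / 2 of H x0. *)
  pose T x := y - (H x - x).
  have Tx0 x : B x -> `|T x - x0| < r.
    move=> Bx; have := hlip x0 x; rewrite /B /= subrr normr0 (ltW r0).
    move=> /(_ isT Bx) h.
    move: Vy; rewrite /V0 -ball_normE /= => Vy.
    have : `|T x - x0| <= `|y - H x0| + `|H x - x - (H x0 - x0)|.
      have -> : T x - x0 = y - H x0 - (H x - x - (H x0 - x0)).
        by rewrite /T; apply/rowP => j; rewrite !mxE; ring.
      exact: ler_normB.
    move: Bx h Vy; rewrite /B /= [`|H x0 - y|]distrC; lra.
  have TB : {homo T : x / B x >-> B x}.
    by move=> x /Tx0; rewrite /B /= => /ltW.
  have cT : is_contraction (mkfun_fun TB).
    exists (2^-1)%:nng; split; first by rewrite /= invf_lt1// ltr1n.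
    move=> [x z] [/= Bx Bz]; rewrite /mkfun_fun /= /mkfun /T.
    have := hlip x z Bx Bz; rewrite distrC [`|z - x|]distrC.
    congr (_ <= _); rewrite -normrN; congr `|_|.
    by apply/rowP => j; rewrite !mxE; ring.
  have cB : closed B.
    exact: closed_cball.
  have [|x Bx Tx] := banach_fixed_point cT cB.
    by exists x0; rewrite /B /= subrr normr0 ltW.
  exists x => _; have xT : x = T x by [].
  split; first by rewrite xT; exact: Tx0.
  move: xT; rewrite /T => /eqP; rewrite eq_sym subr_eq => /eqP ->.
  by rewrite addrC subrK.
have [G hG] := choice Gex.
have GB y : V0 y -> B (G y) by move=> /hG[/ltW].
have HG y : V0 y -> H (G y) = y by move=> /hG[].
pose W := ball x0 r.
have WB x : W x -> B x by rewrite /W -ball_normE /= distrC /B /= => /ltW.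
pose U0 := W `&` H @^-1` V0.
have U0G y : V0 y -> U0 (G y).
  move=> Vy; split; last by rewrite /= HG.
  by rewrite /W -ball_normE /= distrC; case: (hG y Vy).
have GH x : U0 x -> G (H x) = x.
  move=> [/WB Bx Vx]; apply/eqP; rewrite -subr_eq0 -normr_le0.
  have := Hlip _ _ Bx (GB _ Vx).
  by rewrite HG// subrr normr0 mulr0.
have oV0 : open V0 by exact: ball_open.
have oU0 : open U0.
  rewrite openE => x [Wx Vx]; apply: filterI.
    by apply: open_nbhs_nbhs; split=> //; exact: ball_open.
  have : {for x, continuous H}.
    by apply: smooth_on_continuous sH _; exact/BU/WB.
  by apply; exact: open_nbhs_nbhs.
have uJ x : B x -> jacobian H x \in unitmx.
  move=> Bx; apply: inj_unitmx => v vJ; have [_ /(_ v)] := hr x Bx.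
  rewrite vJ sub0r normrN => h; apply/eqP; rewrite -normr_le0.
  have := normr_ge0 v; lra.
have dG y : V0 y -> is_diff y G (mulmxr (invmx (jacobian H (G y)))).
  move=> Vy; apply: is_diff_approx; first exact: linear_mx_continuous.
  move=> e e0; set x := G y; set J := jacobian H x.
  have Bx : B x by exact: GB.
  (* With D = G (k + y) - G y, the error D - k J^-1 is -rho J^-1, where
     rho = k - D J is the error of the linear approximation of H at G y. *)
  pose c := 2 * n%:R * (1 + `|invmx J|).
  have c0 : 0 <= c by rewrite !mulr_ge0// addr_ge0.
  have c10 : 0 < 1 + c by rewrite ltr_pwDl.
  have ec0 : 0 < e / (1 + c) by rewrite divr_gt0.
  have := diff_approx (dB x Bx) ec0.
  move=> /nbhs_ballP[d /= d0 hd].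
  have Vk : \forall k \near (0 : 'rV[R]_n), V0 (k + y).
    by apply: (@near_shift0 _ _ V0); exact: open_nbhs_nbhs.
  have dk : \forall k \near (0 : 'rV[R]_n), `|k| < d / 2.
    by apply: nbhs0_lt; rewrite divr_gt0.
  move: Vk dk; apply: filterS2 => k Vk dk.
  set x' := G (k + y); pose D := x' - x.
  have Bx' : B x' by exact: GB.
  have Dk : `|D| <= 2 * `|k|.
    by have := Hlip _ _ Bx Bx'; rewrite !HG// addrK.
  have := hd D; rewrite -ball_normE /= sub0r normrN.
  have -> : `|D| < d by move: Dk dk; lra.
  move=> /(_ isT); rewrite dE//= /D subrK !HG// addrK -/D -/J => rho.
  have -> : D - k *m invmx J = (k - D *m J) *m (- invmx J).
    by rewrite mulmxN mulmxBl mulmxK ?uJ// opprB.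
  apply: le_trans (norm_mulmx _ _) _; rewrite normrN.
  apply: (@le_trans _ _ (n%:R * (e / (1 + c) * (2 * `|k|)) * (1 + `|invmx J|))).
    apply: ler_pM => //; rewrite ?mulr_ge0// ?lerDr//.
    apply: ler_wpM2l => //; apply: le_trans rho _.
    by rewrite ler_wpM2l// ltW.
  have -> : n%:R * (e / (1 + c) * (2 * `|k|)) * (1 + `|invmx J|) =
     e * `|k| * (c / (1 + c)).
    by rewrite /c; ring.
  rewrite -[leRHS]mulr1 ler_wpM2l ?mulr_ge0 ?(ltW e0)//.
  by rewrite ler_pdivrMr// mul1r lerDr.
have sK v : smooth_on W (fun x => v *m invmx (jacobian H x)).
  apply: smooth_on_mulmx; [exact: ball_open|exact: smooth_on_cst|].
  apply: smooth_on_invmx; [exact: ball_open|by move=> x /WB; exact: uJ|].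
  by apply: smooth_on_sub (smooth_on_jacobian oU sH) => x /WB /BU.
have sG : smooth_on V0 G.
  elim=> [|k IH].
    move=> y Vy; have := dG y Vy; move=> dGy.
    by apply: differentiable_continuous; exact: ex_diff.
  split=> [y /dG dGy|v]; first exact: ex_diff.
  have h : Ck_on k V0 ((fun x => v *m invmx (jacobian H x)) \o G).
    apply/Ck_on_mxP => // i j.
    apply: (@Ck_on_comp _ _ _ k V0 W G (fun x => (v *m invmx (jacobian H x)) i j)) => //.
      by move=> y /U0G[].
    by apply: (Ck_on_mxP k _ _).1; [exact: ball_open|exact: sK].
  apply: Ck_on_eq h => // y /set_mem Vy; have dGy := dG y Vy.
  rewrite deriveE; last exact: ex_diff.
  by rewrite diff_val.
exists U0, V0, G; split; [split=> //|split=> //].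
- split; first by rewrite /W; exact: ballxx.
  by rewrite /= /V0; apply: ballxx; rewrite divr_gt0.
- by move=> x [/WB/BU].
- by move=> x U0x; split; [case: U0x|exact: GH].
Qed.
End InverseFunction.

(** Instead of completing [F] to a local diffeomorphism of R^N, compose it with a
    linear map [A] that is a left inverse of its derivative at [x0]: the inverse
    function theorem applies to [A \o F], a map of R^n to itself, and
    (A \o F)^-1 \o A is the left inverse. *)
Lemma immersion_left_inverse (R : realType) n N (U : set 'rV[R]_n)
    (F : 'rV[R]_n -> 'rV[R]_N) x0 : open U -> U x0 -> smooth_on U F ->
  (forall v, 'd F x0 v = 0 -> v = 0) ->
  exists U0 V r, [/\ open U0, U0 x0, U0 `<=` U, open V & smooth_on V r] /\
    (forall x, U0 x -> V (F x) /\ r (F x) = x) /\ (forall y, V y -> U0 (r y)).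
Proof.
move=> oU Ux0 sF iF.
have dF : differentiable F x0 by exact: smooth_on_differentiable sF Ux0.
have dE v : 'd F x0 v = v *m jacobian F x0 by rewrite -deriveE// deriveEjacobian.
have /row_freeP[A DA] : row_free (jacobian F x0).
  rewrite -kermx_eq0; apply/eqP/row_matrixP => i.
  by rewrite row0; apply: iF; rewrite dE -row_mul mulmx_ker row0.
pose H := mulmxr A \o F.
have sH : smooth_on U H.
  apply: (smooth_on_comp_mx oU openT _ sF) => //.
  by apply: smooth_on_linear; exact: openT.
have dH : jacobian H x0 = 1%:M.
  rewrite -DA; apply/row_matrixP => i.
  rewrite !rowE -deriveEjacobian; last exact: smooth_on_differentiable sH Ux0.
  have dA x : differentiable (mulmxr A : 'rV[R]_N -> 'rV[R]_n) x.
    by apply: linear_differentiable; exact: linear_mx_continuous.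
  rewrite deriveE; last exact: smooth_on_differentiable sH Ux0.
  rewrite diff_comp//= diff_lin; last exact: linear_mx_continuous.
  by rewrite /= dE mulmxA.
have [U0 [V0 [G [[oU0 U0x U0U oV0 sG] [U0G GU0]]]]] := inverse_function oU Ux0 sH dH.
exists U0, (mulmxr A @^-1` V0), (G \o mulmxr A).
have oV : open (mulmxr A @^-1` V0 : set 'rV[R]_N).
  by apply: open_comp => // x _; exact: linear_mx_continuous.
split; first split=> //.
  apply: (smooth_on_comp_mx oV oV0 _ _ sG) => //.
  exact: smooth_on_linear.
by split=> // y Vy; exact: GU0.
Qed.

(** * Determinants *)

(** Such an [X] is complex linear for the structure [J], and its real determinant
    is the squared modulus of its complex one.  Concretely, with
    e = (1 - i J) / 2 and e' = (1 + i J) / 2 complementary projectors commuting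
    with [X], X = (X e + e') (e + X e'), and the two factors are conjugate. *)
Lemma det_commuting_ge0 (R : rcfType) N (J X : 'M[R]_N) :
  J *m J = - 1%:M -> X *m J = J *m X -> 0 <= \det X.
Proof.
move=> J2 XJ; pose toC := map_mx (real_complex R).
pose i : R[i] := 'i%C.
have i2 : i * i = -1 by rewrite -expr2 sqr_i.
pose JC := toC _ _ J; pose XC := toC _ _ X.
have JC2 : JC *m JC = - 1%:M.
  by rewrite /JC /toC -map_mxM J2 map_mxN map_mx1.
have XJC : XC *m JC = JC *m XC by rewrite /JC /XC /toC -!map_mxM XJ.
pose K := i *: JC.
have K2 : K *m K = 1%:M.
  by rewrite -scalemxAl -scalemxAr scalerA i2 JC2 scaleN1r opprK.
have XK : XC *m K = K *m XC by rewrite -scalemxAl -scalemxAr XJC.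
pose e : 'M[R[i]]_N := 2^-1 *: (1%:M - K).
pose e' : 'M[R[i]]_N := 2^-1 *: (1%:M + K).
have two : 2^-1 + 2^-1 = 1 :> R[i] by rewrite [RHS](splitr 1) div1r.
have ee' : e + e' = 1%:M.
  by rewrite /e /e' -scalerDr addrACA addNr addr0 scalerDr -scalerDl two scale1r.
have e_e' : e *m e' = 0.
  rewrite /e /e' -scalemxAl -scalemxAr mulmxBl mul1mx mulmxDr mulmx1 K2.
  by rewrite [K + _]addrC subrr !scaler0.
have e'_e : e' *m e = 0.
  rewrite /e /e' -scalemxAl -scalemxAr mulmxDl mul1mx mulmxBr mulmx1 K2.
  by rewrite addrA subrK subrr !scaler0.
have eidem : e *m e = e by rewrite -{2}[e](addrK e') ee' mulmxBr mulmx1 e_e' subr0.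
have e'idem : e' *m e' = e'.
  by rewrite -{2}[e'](addKr e) ee' mulmxDr mulmxN mulmx1 e'_e oppr0 add0r.
have eX : e *m XC = XC *m e.
  by rewrite /e -scalemxAl -scalemxAr mulmxBl mulmxBr mul1mx mulmx1 XK.
have e'X : e' *m XC = XC *m e'.
  by rewrite /e' -scalemxAl -scalemxAr mulmxDl mulmxDr mul1mx mulmx1 XK.
pose Y := XC *m e + e'; pose Z := e + XC *m e'.
have YZ : Y *m Z = XC.
  rewrite mulmxDl !mulmxDr -!mulmxA eidem e'_e add0r.
  rewrite [e *m (XC *m e')]mulmxA eX -mulmxA e_e' !mulmx0 addr0.
  by rewrite [e' *m (XC *m e')]mulmxA e'X -mulmxA e'idem -mulmxDr ee' mulmx1.
have cC (A : 'M[R]_N) : map_mx conjc (toC _ _ A) = toC _ _ A.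
  by apply/matrixP => k l; rewrite !mxE conjc_real.
have ci : conjc i = - i by apply/eqP; rewrite eq_complex /= oppr0 !eqxx.
have c2 : conjc (2^-1 : R[i]) = 2^-1 by rewrite conjc_inv conjc_nat.
have ce : map_mx conjc e = e'.
  have cK : map_mx conjc K = - K.
    by rewrite /K map_mxZ cC -scaleNr; congr (_ *: _); exact: ci.
  by rewrite map_mxZ map_mxB map_mx1 cK opprK; congr (_ *: _); exact: c2.
have ce' : map_mx conjc e' = e.
  by rewrite -ce; apply/matrixP => k l; rewrite mxE mxE conjcK.
have cY : map_mx conjc Y = Z.
  by rewrite map_mxD map_mxM ce ce' cC addrC.
have dX : \det XC = (\det X)%:C%C by rewrite det_map_mx.
have : 0 <= \det XC.
  rewrite -YZ det_mulmx -cY det_map_mx.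
  case: (\det Y) => a b /=; rewrite lecE /=; apply/andP; split.
    by rewrite mulrN [b * a]mulrC addrC subrr.
  by rewrite mulrN opprK addr_ge0// -expr2 sqr_ge0.
by rewrite dX -[0]/(0%:C%C) lecR.
Qed.

(** The determinant of [1 + t E] is 1 at [t = 0] and has no zero for [t] in
    [0, 1]. *)
Lemma det_1add_gt0 (R : realType) N (E : 'M[R]_N) :
  N%:R * `|E| < 1 -> 0 < \det (1%:M + E).
Proof.
move=> NE; rewrite ltNge; apply/negP => dE.
pose p : {poly R} := \det (1%:M + 'X *: map_mx polyC E).
have pE t : p.[t] = \det (1%:M + t *: E).
  rewrite -[LHS]/(horner_eval t p) /p -det_map_mx; congr (\det _).
  apply/matrixP => k l; rewrite !mxE /= /horner_eval hornerD hornerM hornerX hornerC.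
  by case: (k == l); rewrite /= ?hornerC.
have [||t /andP[t0 t1] /rootP] := @poly_ivt R (- p) 0 1.
- exact: ler01.
- by rewrite !hornerN !pE scale0r addr0 det1 scale1r oppr_le0 ler01 oppr_ge0.
rewrite hornerN pE => /eqP; rewrite oppr_eq0 => /eqP/eqP/det0P[v v0].
rewrite mulmxDr mulmx1 -scalemxAr => /eqP; rewrite addr_eq0 => /eqP vE.
have : `|v| <= N%:R * `|E| * `|v|.
  rewrite {1}vE normrN normrZ ger0_norm//.
  rewrite (le_trans (ler_piMl _ t1))// mulrAC.
  exact: norm_mulmx.
by rewrite leNgt gtr_pMl ?NE ?normr_gt0.
Qed.

(** * Meager sets, and smooth images of lower dimension *)

Section Meager.
Variable R : realType.

Definition hollow N (C : set 'rV[R]_N) :=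
  forall x e, 0 < e -> ~ (ball x e `<=` C).

Definition meager N (A : set 'rV[R]_N) := exists C : nat -> set 'rV[R]_N,
  (forall k, closed (C k) /\ hollow (C k)) /\ A `<=` \bigcup_k C k.

Lemma hollow0 N : hollow (set0 : set 'rV[R]_N).
Proof. by move=> x e e0 /(_ x (ballxx x e0)). Qed.

Lemma meager_countable N (T : Type) (D : set T) (C : T -> set 'rV[R]_N) :
  countable D -> (forall t, D t -> closed (C t) /\ hollow (C t)) ->
  meager (\bigcup_(t in D) C t).
Proof.
move=> /countable_injP[f injf] CD.
exists (fun k => if pselect (exists2 t, D t & f t = k) is left h
  then C (s2val (cid2 h)) else set0); split=> [k|x [t Dt Ctx]].
  case: pselect => [h|_]; last by split; [exact: closed0|exact: hollow0].
  by case: cid2 => t Dt _ /=; exact: CD.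
exists (f t) => //; case: pselect => [h|[]]; last by exists t.
case: cid2 => s Ds fst /=.
by rewrite (injf s t) ?inE.
Qed.

Lemma meager_sub N (A B : set 'rV[R]_N) : A `<=` B -> meager B -> meager A.
Proof. by move=> AB [C [hC BC]]; exists C; split=> // x /AB /BC. Qed.

Lemma meager0 N : meager (set0 : set 'rV[R]_N).
Proof.
exists (fun=> set0); split=> [k|//].
by split; [exact: closed0|exact: hollow0].
Qed.

Lemma meagerU N (A B : set 'rV[R]_N) : meager A -> meager B -> meager (A `|` B).
Proof.
move=> [C [hC AC]] [D [hD BD]].
pose E (bk : bool * nat) := if bk.1 then C bk.2 else D bk.2.
apply: (@meager_sub _ _ (\bigcup_(bk in setT) E bk)).
  move=> x [/AC[k _ Ck]|/BD[k _ Dk]]; first by exists (true, k).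
  by exists (false, k).
apply: meager_countable; first exact: countableP.
by case=> [[] k] _ /=; [exact: hC|exact: hD].
Qed.

Lemma meager_avoid N (A : set 'rV[R]_N) : meager A -> exists u, ~ A u.
Proof.
move=> [C [hC AC]].
have /Baire : forall k, open (~` C k) /\ dense (~` C k).
  move=> k; have [cC hk] := hC k; split; first exact: closed_openC.
  move=> O [x Ox] oO; apply: contrapT => nO.
  have /nbhs_ballP[e /= e0 eO] : nbhs x O by exact: open_nbhs_nbhs.
  apply: (hk x e e0) => y /eO Oy; apply: contrapT => nCy.
  by apply: nO; exists y.
move=> /(_ setT) []; [by exists 0|exact: openT|move=> u [_ hu]].
by exists u => /AC[k _]; exact: hu.
Qed.

(** Pigeonhole.  A ball in the image would contain n1^N points at mutual distance
    at least e / (2 n1).  Their preimages lie in different cells of a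
    subdivision of the cube of radius [rho] into cells of side
    e / (4 L n1), of which there are at most (b n1)^d for a constant [b].  As
    d < N, this fails for n1 = b^d + 1. *)
Lemma lipschitz_image_hollow d N (S : set 'rV[R]_d) (F : 'rV[R]_d -> 'rV[R]_N)
    c rho L : (d < N)%N -> 0 < L -> 0 <= rho ->
  (forall x, S x -> `|x - c| <= rho) ->
  (forall x y, S x -> S y -> `|F x - F y| <= L * `|x - y|) ->
  hollow (F @` S).
Proof.
move=> dN L0 rho0 Srho FL y0 e e0 yF.
pose a := Num.truncn (8 * rho * L / e).
pose b := a.+2.
pose n1 := (b ^ d).+1.
have n10 : 0 < n1%:R :> R by rewrite ltr0n.
pose y (k : {ffun 'I_N -> 'I_n1}) : 'rV[R]_N :=
  \row_j (y0 ord0 j + e / (2 * n1%:R) * (k j)%:R).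
have yB k : ball y0 e (y k).
  rewrite -ball_normE /=; apply: (@le_lt_trans _ _ (e / 2)); last first.
    by rewrite ltr_pdivrMr// ltr_pMr// ltr1n.
  apply: mx_norm_leP => [|i j]; first by rewrite divr_ge0// ltW.
  rewrite ord1 !mxE opprD addrA subrr add0r normrN ger0_norm; last first.
    by rewrite mulr_ge0// divr_ge0 ?ltW// mulr_gt0.
  rewrite invfM mulrA -mulrA ger_pMr ?divr_gt0// mulrC ler_pdivrMr// mul1r ler_nat.
  exact/ltnW/ltn_ord.
have /choice[x hx] : forall k, exists x, S x /\ F x = y k.
  by move=> k; have [x Sx Fx] := yF _ (yB k); exists x.
have ydist k l : k != l -> e / (2 * n1%:R) <= `|y k - y l|.
  move=> kl; have [j kj] : exists j, k j != l j.
    by apply/existsP; apply: contraNT kl; rewrite negb_exists => /forallP h;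
      apply/eqP/ffunP => j; apply/eqP; rewrite -[_ == _]negbK.
  apply: le_trans (mx_norm_entry _ ord0 j).
  rewrite !mxE opprD addrACA subrr add0r -mulrBr normrM.
  rewrite gtr0_norm ?divr_gt0 ?mulr_gt0// ler_pMr ?divr_gt0 ?mulr_gt0//.
  wlog : k l kl kj / (l j < k j)%N => [hw|lk].
    have [|kl'|/val_inj/eqP] := ltngtP (l j) (k j); last by rewrite eq_sym (negPf kj).
      exact: hw.
    by rewrite distrC; apply: hw; rewrite // eq_sym.
  by rewrite -natrB ?(ltnW lk)// ger0_norm// ler1n subn_gt0.
pose s := e / (4 * L * n1%:R).
have s0 : 0 < s by rewrite divr_gt0// !mulr_gt0.
pose t k (j : 'I_d) := (x k ord0 j - c ord0 j + rho) / s.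
have t0 k j : 0 <= t k j <= 2 * rho / s.
  have := Srho _ (hx k).1 => /(le_trans (mx_norm_entry _ ord0 j)).
  rewrite !mxE ler_norml => /andP[h1 h2]; apply/andP; split.
    by rewrite /t divr_ge0 ?(ltW s0)//; lra.
  by rewrite ler_pM2r ?invr_gt0//; lra.
have tb k j : (Num.truncn (t k j) < b * n1)%N.
  have /andP[tk0 tk1] := t0 k j.
  have /andP[h1 _] := truncn_itv tk0.
  rewrite -(ltr_nat R); apply: le_lt_trans h1 _; apply: le_lt_trans tk1 _.
  have -> : 2 * rho / s = 8 * rho * L / e * n1%:R.
    rewrite /s; field; rewrite ?gt_eqF//.
  rewrite natrM ltr_pM2r//.
  have A0 : 0 <= 8 * rho * L / e by rewrite divr_ge0 ?(ltW e0)// mulr_ge0 ?(ltW L0)// mulr_ge0.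
  have /andP[_ h2] := truncn_itv A0.
  by apply: lt_trans h2 _; rewrite ltr_nat.
pose idx k : {ffun 'I_d -> 'I_(b * n1)} := [ffun j => Ordinal (tb k j)].
have inj_idx : injective idx.
  move=> k l kl; apply/eqP; apply: contraT => /ydist.
  rewrite -(hx k).2 -(hx l).2 => h.
  have := le_trans h (FL _ _ (hx k).1 (hx l).1).
  have : `|x k - x l| <= s.
    apply: mx_norm_leP => [|i j]; first exact: ltW.
    rewrite ord1 !mxE.
    have := congr1 (fun f : {ffun 'I_d -> 'I_(b * n1)} => nat_of_ord (f j)) kl.
    rewrite !ffunE /= => tkl.
    have /andP[tk0 _] := t0 k j; have /andP[tl0 _] := t0 l j.
    have /andP[] := truncn_itv tk0; have /andP[] := truncn_itv tl0.
    rewrite tkl -natr1 => h1 h2 h3 h4.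
    have -> : x k ord0 j - x l ord0 j = (t k j - t l j) * s.
      by rewrite -mulrBl divfK ?gt_eqF//; ring.
    by rewrite normrM (gtr0_norm s0) ger_pMl// ler_norml; apply/andP; split; lra.
  move=> xs hL; suff : e / (2 * n1%:R) < e / (2 * n1%:R) by rewrite ltxx.
  apply: le_lt_trans hL _.
  apply: (@le_lt_trans _ _ (L * s)); first by rewrite ler_wpM2l// ltW.
  have -> : L * s = e / (2 * n1%:R) / 2 by rewrite /s; field; rewrite ?gt_eqF.
  by rewrite ltr_pdivrMr// ltr_pMr ?ltr1n// divr_gt0// mulr_gt0.
have := leq_card idx inj_idx; rewrite !card_ffun !card_ord expnMn.
apply/negP; rewrite -ltnNge.
apply: (@leq_trans (n1 ^ d.+1)%N); last by rewrite leq_pexp2l.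
by rewrite expnS ltn_mul2r expn_gt0 /=.
Qed.

Lemma smooth_locally_lipschitz d N (U : set 'rV[R]_d) (F : 'rV[R]_d -> 'rV[R]_N) x :
  open U -> smooth_on U F -> U x -> exists r L, [/\ 0 < r, 0 < L,
    [set y | `|y - x| <= r] `<=` U &
    forall y z, `|y - x| <= r -> `|z - x| <= r -> `|F y - F z| <= L * `|y - z|].
Proof.
move=> oU sF Ux.
have cJ : {for x, continuous (jacobian F)}.
  exact: smooth_on_continuous (smooth_on_jacobian oU sF) Ux.
have : \forall y \near x, U y /\ `|jacobian F x - jacobian F y| < 1.
  have Un : \forall y \near x, U y by exact: open_nbhs_nbhs.
  move/cvgrPdist_lt: cJ => /(_ _ ltr01).
  by move: Un; apply: filterS2 => y.
move=> /nbhs_cball[r r0 rU].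
pose L : R := d%:R * (`|jacobian F x| + 1) + 1.
have L0 : 0 < L by rewrite ltr_wpDl// mulr_ge0// addr_ge0.
exists r, L; split => //.
  by move=> y /rU[].
move=> y z yx zx.
apply: (@mean_value_ineq R d N [set y | `|y - x| <= r] F L _ _ _ _ z y zx yx).
- exact: ltW.
- by move=> ? ? ?; exact: cball_convex.
- by move=> w /rU[Uw _]; exact: smooth_on_differentiable sF Uw.
- move=> w v /rU[Uw Jw]; have dF := smooth_on_differentiable sF Uw.
  rewrite -deriveE// deriveEjacobian//.
  apply: le_trans (norm_mulmx _ _) _; rewrite mulrAC ler_wpM2r//.
  apply: (@le_trans _ _ (d%:R * (`|jacobian F x| + 1))); last by rewrite lerDl.
  rewrite ler_wpM2l//.
  move: Jw; move: (jacobian F x) (jacobian F w) => A B AB.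
  have -> : B = A - (A - B) by rewrite opprB addrC subrK.
  by rewrite (le_trans (ler_normB _ _))// lerD2l ltW.
Qed.

(** A smooth map is locally Lipschitz, and countably many compact pieces on which
    it is Lipschitz cover the domain. *)
Lemma meager_smooth_image d N (U : set 'rV[R]_d) (F : 'rV[R]_d -> 'rV[R]_N) :
  (d < N)%N -> open U -> smooth_on U F -> meager (F @` U).
Proof.
move=> dN oU sF; have [B cB [oB bB]] := @rV_second_countable R d.
pose good (V : set 'rV[R]_d) := exists c rho L, [/\ 0 <= rho, 0 < L,
  closure V `<=` U, closure V `<=` [set x | `|x - c| <= rho] &
  forall x y, closure V x -> closure V y -> `|F x - F y| <= L * `|x - y|].
apply: (@meager_sub _ _ (\bigcup_(V in B `&` good) F @` closure V)); last first.
  apply: meager_countable; first exact: sub_countable (subset_card_le (@subIsetl _ B good)) cB.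
  move=> V [BV [c [rho [L [rho0 L0 VU Vrho FL]]]]]; split.
    apply: compact_closed; first exact: norm_hausdorff.
    apply: continuous_compact.
      apply: continuous_in_subspaceT => x /set_mem /VU Ux.
      exact: smooth_on_continuous sF Ux.
    exact: subclosed_compact (@closed_closure _ V) (@compact_cball R d c rho) Vrho.
  exact: lipschitz_image_hollow dN L0 rho0 Vrho FL.
move=> _ [x Ux <-].
have [r [L [r0 L0 rU FL]]] := smooth_locally_lipschitz oU sF Ux.
have xr : nbhs x [set y | `|y - x| <= r].
  apply/nbhs_ballP; exists r => //= y; rewrite -ball_normE /= distrC; exact: ltW.
have [V [BV Vx] Vr] := bB x _ xr.
have cVr : closure V `<=` [set y | `|y - x| <= r].
  by have := closure_subset Vr; rewrite -((closure_id _).1 (@closed_cball _ _ x r)).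
exists V; last by exists x => //; exact: subset_closure.
split=> //; exists x, r, L; split=> //; first exact: ltW.
  by move=> y /cVr /rU.
by move=> y z /cVr yr /cVr; exact: FL.
Qed.
End Meager.

(** * Smooth functions on manifolds, and embeddings in a space of large dimension *)

Lemma diff_linear_comp (R : realType) (V : normedModType R) p q (W : normedModType R)
    (L : {linear 'M[R]_(p, q) -> W}) (F : V -> 'M[R]_(p, q)) x v :
  differentiable F x -> 'd (L \o F) x v = L ('d F x v).
Proof.
move=> dF; have cL : continuous L by exact: linear_mx_continuous.
rewrite diff_comp//=; last exact: linear_differentiable.
by rewrite diff_lin.
Qed.

Lemma diff_row_mx (R : realType) (V : normedModType R) r s
    (F : V -> 'rV[R]_r) (G : V -> 'rV[R]_s) x v :
  differentiable (fun y => row_mx (F y) (G y)) x ->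
  'd (fun y => row_mx (F y) (G y)) x v = row_mx ('d F x v) ('d G x v).
Proof.
set H := fun y => _; move=> dH.
have EF : lsubmx \o H = F by apply/funext => y; rewrite /= row_mxKl.
have EG : rsubmx \o H = G by apply/funext => y; rewrite /= row_mxKr.
have := @diff_linear_comp _ _ _ _ _ lsubmx H x v dH; rewrite EF => ->.
have := @diff_linear_comp _ _ _ _ _ rsubmx H x v dH; rewrite EG => ->.
by rewrite hsubmxK.
Qed.

Lemma diff_near_comp (R : realType) (V W W' : normedModType R)
    (F : W -> W') (T : V -> W) (G : V -> W') x v :
  differentiable T x -> differentiable F (T x) ->
  (\forall y \near x, F (T y) = G y) -> 'd G x v = 'd F (T x) ('d T x v).
Proof.
move=> dT dF E; have dc := differentiable_comp dT dF.
have dE := @near_eq_is_diff _ _ _ (F \o T) G x E dc.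
by rewrite (@diff_val _ _ _ _ _ G _ dE) (diff_comp dT dF).
Qed.

Lemma diff_near_id (R : realType) (V : normedModType R) (G : V -> V) x v :
  (\forall y \near x, y = G y) -> 'd G x v = v.
Proof.
move=> E; have di := is_diff_id x.
have dE := @near_eq_is_diff _ _ _ id G x E (@ex_diff _ _ _ _ _ _ _ di).
by rewrite (@diff_val _ _ _ _ _ G _ dE) (@diff_val _ _ _ _ _ _ _ di).
Qed.

Lemma diff_retract_inj (R : realType) (V W : normedModType R)
    (F : W -> V) (T : V -> W) x v :
  differentiable T x -> differentiable F (T x) ->
  (\forall y \near x, F (T y) = y) -> 'd T x v = 0 -> v = 0.
Proof.
move=> dT dF E Tv.
have FT0 : 'd (F \o T) x v = 0 by rewrite (diff_comp dT dF) /= Tv linear0.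
rewrite -FT0; apply/esym/diff_near_id.
by apply: filterS E => y.
Qed.

Section Manifold.
Variables (R : realType) (n : nat) (M : smoothManifold R n).
Implicit Types (i j : mindex M) (p q : M).

Local Notation dom i := (cdom (mchart i)).
Local Notation cod i := (ccod (mchart i)).
Local Notation phi i := (cmap (mchart i)).
Local Notation psi i := (cinv (mchart i)).

Definition in_chart (T : Type) i (F : M -> T) : 'rV[R]_n -> T := fun x => F (psi i x).

Definition smfun (W : normedModType R) (F : M -> W) :=
  forall i, smooth_on (cod i) (in_chart i F).

Definition transition i j : 'rV[R]_n -> 'rV[R]_n :=
  coord_rep (mchart i) (mchart j) (id : M -> M).

Lemma cod_phi i p : dom i p -> cod i (phi i p).
Proof. exact: cmap_ccod. Qed.

Lemma open_overlap i j : open (coord_dom (mchart i) (mchart j) (id : M -> M)).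
Proof.
rewrite openE => x [ix jx]; apply: filterI.
  by apply: open_nbhs_nbhs; split=> //; exact: ccod_open.
have := cinv_continuous ix; apply.
by apply: open_nbhs_nbhs; split=> //; exact: cdom_open.
Qed.

Lemma overlap_phi i j p : dom i p -> dom j p ->
  coord_dom (mchart i) (mchart j) (id : M -> M) (phi i p).
Proof. by move=> ip jp; split; [exact: cod_phi|rewrite /= cmapK]. Qed.

Lemma transition_phi i j p : dom i p -> transition i j (phi i p) = phi j p.
Proof. by move=> ip; rewrite /transition /coord_rep cmapK. Qed.

Lemma in_chart_transition (T : Type) (F : M -> T) i j x :
  coord_dom (mchart i) (mchart j) (id : M -> M) x ->
  in_chart i F x = in_chart j F (transition i j x).
Proof. by move=> [ix jx]; rewrite /in_chart /transition /coord_rep cmapK. Qed.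

Lemma transition_smooth i j :
  smooth_on (coord_dom (mchart i) (mchart j) (id : M -> M)) (transition i j).
Proof. exact: mtransition. Qed.

Lemma transition_differentiable i j p : dom i p -> dom j p ->
  differentiable (transition i j) (phi i p).
Proof.
move=> ip jp; exact: smooth_on_differentiable (@transition_smooth i j) (overlap_phi ip jp).
Qed.

Lemma near_overlap i j p : dom i p -> dom j p ->
  \forall x \near phi i p, coord_dom (mchart i) (mchart j) (id : M -> M) x.
Proof.
move=> ip jp; apply: open_nbhs_nbhs.
by split; [exact: open_overlap|exact: overlap_phi].
Qed.

(** The derivative of [F] in two charts differs by the change of coordinates in
    the tangent space. *)
Lemma diff_in_chart_transition (W : normedModType R) (F : M -> W) i j p v :
  differentiable (in_chart j F) (phi j p) -> dom i p -> dom j p ->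
  'd (in_chart i F) (phi i p) v =
  'd (in_chart j F) (phi j p) ('d (transition i j) (phi i p) v).
Proof.
move=> dF ip jp; have dT := transition_differentiable ip jp.
have E : \forall x \near phi i p, (in_chart j F \o transition i j) x = in_chart i F x.
  by apply: filterS (near_overlap ip jp) => x xd /=; rewrite (in_chart_transition F xd).
move: dF; rewrite -(transition_phi j ip) => dF.
exact: (@diff_near_comp _ _ _ _ (in_chart j F) (transition i j) (in_chart i F)).
Qed.

Lemma tangent_id_inj i j p v : dom i p -> dom j p ->
  'd (transition i j) (phi i p) v = 0 -> v = 0.
Proof.
move=> ip jp Tv.
have dF := transition_differentiable jp ip; rewrite -(transition_phi j ip) in dF.
apply: (@diff_retract_inj _ _ _ (transition j i) (transition i j) (phi i p) v) => //.
  exact: transition_differentiable.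
by apply: filterS (near_overlap ip jp) => x [ix jx]; rewrite /transition /coord_rep cmapK// cinvK.
Qed.

Lemma smfun_differentiable (W : normedModType R) (F : M -> W) i p :
  smfun F -> dom i p -> differentiable (in_chart i F) (phi i p).
Proof. by move=> sF ip; exact: smooth_on_differentiable (sF i) (cod_phi ip). Qed.

Lemma near_dom i p : dom i p -> \forall q \near p, dom i q.
Proof. by move=> ip; apply: open_nbhs_nbhs; split=> //; exact: cdom_open. Qed.

Lemma smfun_continuous (W : normedModType R) (F : M -> W) : smfun F -> continuous F.
Proof.
move=> sF p; have [i ip] := mcover p.
have E : \forall q \near p, in_chart i F (phi i q) = F q.
  by apply: filterS (near_dom ip) => q iq; rewrite /in_chart cmapK.
have c1 : {for p, continuous (in_chart i F \o phi i)}.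
  apply: continuous_comp; first exact: cmap_continuous.
  exact: smooth_on_continuous (sF i) (cod_phi ip).
rewrite /continuous_at -(nbhs_singleton E).
apply: cvg_trans c1; exact: near_eq_cvg E.
Qed.

Lemma smfun_euclidean N (f : M -> 'rV[R]_N) :
  smfun f -> @smooth_map R n N M (euclidean R N) f.
Proof.
move=> sf; split; first exact: (smfun_continuous sf).
move=> i j; apply: smooth_on_sub (sf i); exact: subIsetl.
Qed.

(** The support of [g] is carried to a compact, hence closed, subset of [M]:
    every point outside the chart has a neighbourhood on which the extension
    is 0. *)
Lemma smfun_extend0 i r s (g : 'rV[R]_n -> 'M[R]_(r, s)) (K : set 'rV[R]_n) :
  smooth_on (cod i) g -> compact K -> K `<=` cod i ->
  (forall x, g x != 0 -> K x) ->
  smfun (fun q => if pselect (dom i q) then g (phi i q) else 0).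
Proof.
move=> sg cK Kcod gK j; apply: smooth_on_local => x jx.
have [ix|nix] := pselect (dom i (psi j x)).
  exists (coord_dom (mchart j) (mchart i) (id : M -> M)); first by split.
  have oO := @open_overlap j i.
  have UV : coord_dom (mchart j) (mchart i) (id : M -> M) `<=` transition j i @^-1` cod i.
    by move=> y [jy iy]; exact: cod_phi.
  have := smooth_on_comp_mx oO (@ccod_open _ _ _ (mchart i)) UV (@transition_smooth j i) sg.
  apply: smooth_on_eq => // y /set_mem[jy iy].
  by rewrite /in_chart; case: pselect.
pose K' := psi i @` K.
have cK' : closed K'.
  apply: compact_closed; first exact: mhausdorff.
  apply: continuous_compact => //.
  apply: continuous_in_subspaceT => y /set_mem /Kcod iy; exact: cinv_continuous.
pose V := cod j `&` psi j @^-1` (~` K').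
have oV : open V.
  rewrite openE => y [jy Ky]; apply: filterI.
    by apply: open_nbhs_nbhs; split=> //; exact: ccod_open.
  have := cinv_continuous jy; apply.
  by apply: open_nbhs_nbhs; split=> //; exact: closed_openC.
exists V.
  by split=> //= -[y Ky yx]; apply: nix; rewrite -yx; exact/cinv_cdom/Kcod.
apply: smooth_on_eq (smooth_on_cst V 0) => // y /set_mem[jy Ky].
rewrite /in_chart; case: pselect => //= iy; apply/esym/eqP; apply: contra_notT Ky => gy.
by exists (phi i (psi j y)); [exact: gK|exact: cmapK].
Qed.

(** Injectivity is required between a point of [A] and every point of [M], so that
    the property passes to the union of two sets when two maps are put side by
    side. *)
Definition embeds_on (A : set M) L (g : M -> 'rV[R]_L) :=
  [/\ smfun g, forall p q, A p -> g p = g q -> p = q &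
      forall p i v, A p -> dom i p -> 'd (in_chart i g) (phi i p) v = 0 -> v = 0].

(** The map is q |-> (b (q), b (q) x (q)) where [x] is a chart at [p] and [b] a
    bump function: where b = 1 the first coordinate tells that the other point
    lies in the chart as well, and the remaining ones are the chart. *)
Lemma embeds_on_local p : exists2 U, nbhs p U &
  exists g : M -> 'rV[R]_(1 + n), embeds_on U g.
Proof.
have [i ip] := mcover p.
have [e e0 eK] : exists2 e, 0 < e & [set x | `|x - phi i p| <= e] `<=` cod i.
  apply: nbhs_cball; apply: open_nbhs_nbhs.
  by split; [exact: ccod_open|exact: cod_phi].
have [b [sb b01 b1 bK]] := bump_exists (phi i p) e0.
pose g x : 'rV[R]_(1 + n) := row_mx (b x)%:M (b x *: x).
have oC := @ccod_open _ _ _ (mchart i).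
have sbi : smooth_on (cod i) b by exact: smooth_on_sub sb.
have sg : smooth_on (cod i) g.
  apply: smooth_on_row_mx => //.
    apply/smooth_on_mxP => // k l; under eq_fun do rewrite mxE ord1 (ord1 l) mulr1n.
    exact: sbi.
  apply: smooth_onZ => //; exact: smooth_on_id.
pose G q := if pselect (dom i q) then g (phi i q) else 0.
have GE q : dom i q -> G q = g (phi i q) by rewrite /G; case: pselect.
have sG : smfun G.
  apply: (smfun_extend0 sg (@compact_cball R n (phi i p) e) eK).
  move=> x gx; apply: bK; apply: contraNN gx => /eqP bx.
  by rewrite /g bx scale0r raddf0 row_mx0.
have [d d0 db] : exists2 d, 0 < d & forall x, ball (phi i p) d x -> b x = 1.
  by move/nbhs_ballP: b1 => [d d0 db]; exists d.
pose U := dom i `&` phi i @^-1` ball (phi i p) d.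
exists U.
  apply: filterI; first exact: near_dom.
  have := cmap_continuous ip; apply; exact: nbhsx_ballx.
exists G; split=> //.
- move=> q q' [iq /db bq]; rewrite GE// /g bq => Gq.
  have iq' : dom i q'.
    move: Gq; rewrite /G; case: pselect => //= _ /(congr1 (fun A : 'rV[R]_(1 + n) => lsubmx A ord0 ord0)).
    by rewrite row_mxKl !mxE => /eqP; rewrite oner_eq0.
  move: Gq; rewrite GE// /g => /eq_row_mx[].
  move=> /(congr1 (fun A : 'M[R]_1 => A ord0 ord0)); rewrite !mxE /= !mulr1n => <-.
  rewrite !scale1r => Gq.
  by rewrite -[q](cmapK iq) Gq cmapK.
- move=> q j v [iq bq] jq.
  rewrite (diff_in_chart_transition _ (smfun_differentiable sG iq) jq iq) => h.
  apply: (tangent_id_inj jq iq); move: h; set w := 'd (transition _ _) _ _ => h.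
  have : 'd (rsubmx \o in_chart i G) (phi i q) w = 0.
    rewrite (@diff_linear_comp _ _ _ _ _ rsubmx); first by rewrite h linear0.
    exact: smfun_differentiable.
  have E : \forall x \near phi i q, x = (rsubmx \o in_chart i G) x.
    have ob : \forall x \near phi i q, ball (phi i p) d x.
      by apply: open_nbhs_nbhs; split=> //; exact: ball_open.
    have oi : \forall x \near phi i q, cod i x.
      by apply: open_nbhs_nbhs; split; [|exact: cod_phi].
    move: ob oi; apply: filterS2 => x /db bx ix.
    by rewrite /= /in_chart GE ?cinvK//; [rewrite /g row_mxKr bx scale1r|exact: cinv_cdom].
  by rewrite (diff_near_id w E).
Qed.

Lemma diff_in_chart_row_mx i p r s (F : M -> 'rV[R]_r) (G : M -> 'rV[R]_s) v :
  smfun F -> smfun G -> dom i p ->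
  'd (in_chart i (fun q => row_mx (F q) (G q))) (phi i p) v =
  row_mx ('d (in_chart i F) (phi i p) v) ('d (in_chart i G) (phi i p) v).
Proof.
move=> sF sG ip; set H := fun q => row_mx (F q) (G q).
have dH : differentiable (in_chart i H) (phi i p).
  apply: (@smfun_differentiable _ H) => // j.
  by apply: smooth_on_row_mx; [exact: ccod_open|exact: sF|exact: sG].
exact: (@diff_row_mx _ _ _ _ (in_chart i F) (in_chart i G)).
Qed.

Lemma embeds_onU A B L L' (g : M -> 'rV[R]_L) (h : M -> 'rV[R]_L') :
  embeds_on A g -> embeds_on B h ->
  embeds_on (A `|` B) (fun q => row_mx (g q) (h q)).
Proof.
move=> [sg ig dg] [sh ih dh]; split.
- by move=> j; apply: smooth_on_row_mx; [exact: ccod_open|exact: sg|exact: sh].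
- by move=> p q AB /eq_row_mx[gpq hpq]; case: AB => [/ig|/ih]; apply.
- move=> p i v AB ip; rewrite diff_in_chart_row_mx// -[X in _ = X -> _](@row_mx0 _ 1 L L').
  by move=> /eq_row_mx[gv hv]; case: AB => [Ap|Bp]; [exact: dg gv|exact: dh hv].
Qed.

Lemma embedding_exists : compact [set: M] -> exists L (g : M -> 'rV[R]_L), embeds_on setT g.
Proof.
move=> cM; pose P (A : set M) := exists L (g : M -> 'rV[R]_L), embeds_on A g.
apply: (@compact_ind M P) => //.
- exists 0%N, (fun=> 0); split=> // i; exact: smooth_on_cst.
- move=> A B AB [L [g [sg ig dg]]]; exists L, g; split=> //.
    by move=> p q /AB; exact: ig.
  by move=> p i v /AB; exact: dg.
- move=> A B [L [g Ag]] [L' [h Bh]]; exists (L + L')%N, (fun q => row_mx (g q) (h q)).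
  exact: embeds_onU.
- by move=> p _; have [U pU [g Ug]] := embeds_on_local p; exists U => //; exists (1 + n)%N, g.
Qed.
End Manifold.

Lemma mul_jacobian (R : realType) n N (f : 'rV[R]_n -> 'rV[R]_N) x v :
  differentiable f x -> v *m jacobian f x = 'd f x v.
Proof. by move=> df; rewrite -deriveEjacobian// deriveE. Qed.

Lemma diff_cst0 (R : realType) (V W : normedModType R) (c : W) x (v : V) :
  'd (fun _ : V => c) x v = 0.
Proof. by have := congr1 (fun f => f v) (diff_cst c x). Qed.

(** * Projections from C^(1 + K) to C^K *)

Section ComplexProduct.
Variables (R : realType) (K K' : nat) (A B : 'M[R]_(K, K')) (t : R).
Implicit Types x y z w : 'rV[R]_K.

Lemma mulmx_re x y z w :
  x *m A + y *m B + t *: (w *m A + z *m (- B)) =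
  (x + t *: w) *m A + (y - t *: z) *m B.
Proof. by rewrite mulmxBl [in RHS]mulmxDl -!scalemxAl mulmxN scalerDr scalerN addrACA. Qed.

Lemma mulmx_im x y z w :
  y *m A + x *m (- B) - t *: (z *m A + w *m B) =
  (y - t *: z) *m A - (x + t *: w) *m B.
Proof. by rewrite mulmxBl [in RHS]mulmxDl -!scalemxAl mulmxN scalerDr !opprD addrACA. Qed.
End ComplexProduct.

(** The vector wa + i wb of C^(1 + K) is projected along the line spanned by
    (1, u) with u = u1 + i u2: it goes to the tail minus the leading coordinate
    times u, which is (wa + i wb) (A - i B) for the real matrices
    A = [projA u] and B = [projB u]. *)
Section ComplexProjection.
Variables (R : realType) (K : nat).
Implicit Types (wa wb : 'rV[R]_(1 + K)) (u : 'rV[R]_(K + K)).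

Definition projA u : 'M[R]_(1 + K, K) := col_mx (- lsubmx u) 1%:M.
Definition projB u : 'M[R]_(1 + K, K) := col_mx (rsubmx u) 0.

Definition lead (w : 'rV[R]_(1 + K)) : R := w ord0 ord0.
Definition tail (w : 'rV[R]_(1 + K)) : 'rV[R]_K := rsubmx w.

Definition sqmod wa wb : R := lead wa * lead wa + lead wb * lead wb.

(** The complex quotient of the tail of wa + i wb by its leading coordinate. *)
Definition slope wa wb : 'rV[R]_(K + K) :=
  row_mx ((sqmod wa wb)^-1 *: (lead wa *: tail wa + lead wb *: tail wb))
         ((sqmod wa wb)^-1 *: (lead wa *: tail wb - lead wb *: tail wa)).

Lemma lead_tail_eq0 (w : 'rV[R]_(1 + K)) : lead w = 0 -> tail w = 0 -> w = 0.
Proof.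
move=> h t; rewrite -[w]hsubmxK -[X in row_mx _ X]/(tail w) t.
rewrite [lsubmx w](_ : _ = 0) ?row_mx0//.
apply/rowP => j; rewrite !mxE ord1; rewrite -[RHS]h; congr (w _ _).
exact/val_inj.
Qed.

Lemma mul_projA w u : w *m projA u = tail w - lead w *: lsubmx u.
Proof.
rewrite -{1}[w]hsubmxK mul_row_col mulmx1 addrC mulmxN; congr (_ - _).
apply/rowP => j; rewrite !mxE big_ord1 !mxE; congr (w _ _ * _).
exact/val_inj.
Qed.

Lemma mul_projB w u : w *m projB u = lead w *: rsubmx u.
Proof.
rewrite -{1}[w]hsubmxK mul_row_col mulmx0 addr0.
apply/rowP => j; rewrite !mxE big_ord1 !mxE; congr (w _ _ * _).
exact/val_inj.
Qed.

Lemma proj_kernel wa wb u :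
  wa *m projA u + wb *m projB u = 0 -> wb *m projA u - wa *m projB u = 0 ->
  (wa = 0 /\ wb = 0) \/ (sqmod wa wb != 0 /\ u = slope wa wb).
Proof.
rewrite !mul_projA !mul_projB => /eqP + /eqP.
rewrite -addrA addr_eq0 opprD opprK => /eqP ta; rewrite -addrA -opprD subr_eq0 => /eqP tb.
have [r0|r0] := eqVneq (sqmod wa wb) 0; [left|right].
  have [/eqP ha /eqP hb] : lead wa == 0 /\ lead wb == 0.
    move/eqP: r0; rewrite /sqmod paddr_eq0 -?expr2 ?sqr_ge0// => /andP[].
    by rewrite !sqrf_eq0.
  by split; apply: lead_tail_eq0 => //; rewrite ?ta ?tb ha hb !scale0r ?subrr ?addr0.
split=> //; rewrite -[LHS]hsubmxK /slope ta tb; congr row_mx; apply/rowP => j;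
  rewrite !mxE; move: r0; rewrite /sqmod => r0; by field.
Qed.
End ComplexProjection.

Lemma meager_slope (R : realType) d K (W : set 'rV[R]_d)
    (wa wb : 'rV[R]_d -> 'rV[R]_(1 + K)) :
  (d < K + K)%N -> open W -> smooth_on W wa -> smooth_on W wb ->
  meager [set u | exists x, [/\ W x, sqmod (wa x) (wb x) != 0 &
    u = slope (wa x) (wb x)]].
Proof.
move=> dK oW sa sb; pose W' := [set x | W x /\ sqmod (wa x) (wb x) != 0].
have shd w : smooth_on W w -> smooth_on W (fun x => lead (w x) : R).
  by move=> sw; exact: (smooth_on_mxP w oW).1.
have stl w : smooth_on W w -> smooth_on W (fun x => tail (w x)).
  move=> /(smooth_on_mxP _ oW) sw; apply/smooth_on_mxP => // i j.
  by under eq_fun do rewrite mxE; exact: sw.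
have ssq : smooth_on W (fun x => sqmod (wa x) (wb x)).
  by apply: smooth_onD => //; apply: smooth_onM => //; exact: shd.
have oW' : open W'.
  rewrite openE => x [Wx rx]; apply: filterI; first exact: open_nbhs_nbhs.
  have c := smooth_on_continuous ssq Wx.
  apply: (c [set r : R | r != 0]); apply: open_nbhs_nbhs; split=> //.
have WW : W' `<=` W by move=> x [].
have sV : smooth_on W' (fun x => (sqmod (wa x) (wb x))^-1).
  apply: smooth_onV => //; first by move=> x [].
  exact: smooth_on_sub ssq.
have sS : smooth_on W' (fun x => slope (wa x) (wb x)).
  have sha := smooth_on_sub WW (shd _ _ sa); have shb := smooth_on_sub WW (shd _ _ sb).
  have sta := smooth_on_sub WW (stl _ _ sa); have stb := smooth_on_sub WW (stl _ _ sb).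
  apply: smooth_on_row_mx => //; apply: smooth_onZ => //.
    by apply: smooth_onD => //; exact: smooth_onZ.
  by apply: smooth_onB => //; exact: smooth_onZ.
apply: meager_sub (meager_smooth_image dK oW' sS) => u [x [Wx rx ->]].
by exists x.
Qed.

(** * Maps to C^K whose derivative deforms to a complex linear map *)

Section GenericPair.
Variables (R : realType) (n : nat) (M : smoothManifold R n) (J : almostComplex M).
Implicit Types (i j : mindex M) (p q : M).

Local Notation dom i := (cdom (mchart i)).
Local Notation cod i := (ccod (mchart i)).
Local Notation phi i := (cmap (mchart i)).
Local Notation psi i := (cinv (mchart i)).

(** The real and imaginary parts of df (v) - t i df (J v), for f = a + i b. *)
Definition re_deform K (a b : M -> 'rV[R]_K) i p (t : R) (v : 'rV[R]_n) : 'rV[R]_K :=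
  v *m jacobian (in_chart i a) (phi i p) + t *: (v *m J i p *m jacobian (in_chart i b) (phi i p)).

Definition im_deform K (a b : M -> 'rV[R]_K) i p (t : R) (v : 'rV[R]_n) : 'rV[R]_K :=
  v *m jacobian (in_chart i b) (phi i p) - t *: (v *m J i p *m jacobian (in_chart i a) (phi i p)).

(** Both parts of df (v) - t i df (J v) vanish only for v = 0: the derivative df,
    at t = 0, is joined to a complex linear map, at t = 1, through injective
    linear maps. *)
Definition generic_pair K (a b : M -> 'rV[R]_K) :=
  [/\ smfun a, smfun b, forall p q, a p = a q -> b p = b q -> p = q &
      forall i p t v, dom i p -> re_deform a b i p t v = 0 -> im_deform a b i p t v = 0 ->
        v = 0].

Lemma jacobian_in_chart_transition K (a : M -> 'rV[R]_K) i j p v : smfun a ->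
  dom i p -> dom j p ->
  v *m jacobian (in_chart i a) (phi i p) =
  ('d (transition i j) (phi i p) v) *m jacobian (in_chart j a) (phi j p).
Proof.
move=> sa ip jp.
have h := diff_in_chart_transition v (smfun_differentiable sa jp) ip jp.
have di := smfun_differentiable sa ip; have dj := smfun_differentiable sa jp.
move: h di dj; move: (in_chart i a) (in_chart j a) ('d (transition i j) (phi i p) v).
by move=> f g w h df dg; rewrite (mul_jacobian _ df) (mul_jacobian _ dg).
Qed.

Lemma jacobian_in_chart_acs K (a : M -> 'rV[R]_K) i j p v : smfun a ->
  dom i p -> dom j p ->
  v *m J i p *m jacobian (in_chart i a) (phi i p) =
  'd (transition i j) (phi i p) v *m J j p *m jacobian (in_chart j a) (phi j p).
Proof.
move=> sa ip jp; apply: etrans (jacobian_in_chart_transition (v *m J i p) sa ip jp) _.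
have tJ : 'd (transition i j) (phi i p) (v *m J i p) = 'd (transition i j) (phi i p) v *m J j p.
  exact: (acs_tensor J ip jp).
exact: (congr1 (fun w => w *m jacobian (in_chart j a) (phi j p)) tJ).
Qed.

Lemma re_deform_transition K (a b : M -> 'rV[R]_K) i j p t v : smfun a -> smfun b ->
  dom i p -> dom j p ->
  re_deform a b i p t v = re_deform a b j p t ('d (transition i j) (phi i p) v).
Proof.
move=> sa sb ip jp.
exact: (congr2 (fun x y => x + t *: y)
  (jacobian_in_chart_transition v sa ip jp) (jacobian_in_chart_acs v sb ip jp)).
Qed.

Lemma im_deform_transition K (a b : M -> 'rV[R]_K) i j p t v : smfun a -> smfun b ->
  dom i p -> dom j p ->
  im_deform a b i p t v = im_deform a b j p t ('d (transition i j) (phi i p) v).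
Proof.
move=> sa sb ip jp.
exact: (congr2 (fun x y => x - t *: y)
  (jacobian_in_chart_transition v sb ip jp) (jacobian_in_chart_acs v sa ip jp)).
Qed.

Lemma smfun_lin K K' (a b : M -> 'rV[R]_K) (A B : 'M[R]_(K, K')) :
  smfun a -> smfun b -> smfun (fun p => a p *m A + b p *m B).
Proof.
move=> sa sb i; have oC := @ccod_open _ _ _ (mchart i).
by apply: smooth_onD => //; apply: smooth_on_mulmx => //; exact: smooth_on_cst.
Qed.

Lemma jacobian_lin K K' (a b : M -> 'rV[R]_K) (A B : 'M[R]_(K, K')) i p (v : 'rV[R]_n) :
  smfun a -> smfun b -> dom i p ->
  v *m jacobian (in_chart i (fun p => a p *m A + b p *m B)) (phi i p) =
  v *m jacobian (in_chart i a) (phi i p) *m A + v *m jacobian (in_chart i b) (phi i p) *m B.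
Proof.
move=> sa sb ip.
have dc := smfun_differentiable (smfun_lin A B sa sb) ip.
have da := smfun_differentiable sa ip; have db := smfun_differentiable sb ip.
have E : in_chart i (fun p => a p *m A + b p *m B) =
  (mulmxr A \o in_chart i a) + (mulmxr B \o in_chart i b) by [].
move: dc; rewrite {}E; move: da db; move: (in_chart i a) (in_chart i b) (phi i p) => f g x df dg dc.
apply: (etrans (mul_jacobian v dc)).
apply: (etrans _ (congr2 (fun y z => y *m A + z *m B)
  (esym (mul_jacobian v df)) (esym (mul_jacobian v dg)))).
have dA : differentiable (mulmxr A \o f) x.
  apply: differentiable_comp => //; apply: linear_differentiable.
  exact: linear_mx_continuous.
have dB : differentiable (mulmxr B \o g) x.
  apply: differentiable_comp => //; apply: linear_differentiable.
  exact: linear_mx_continuous.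
apply: (etrans (congr1 (fun h => h v) (diffD dA dB))).
exact: (congr2 +%R (@diff_linear_comp _ _ _ _ _ (mulmxr A) f x v df)
  (@diff_linear_comp _ _ _ _ _ (mulmxr B) g x v dg)).
Qed.

(** In charts around [p] and [q], the secants are parametrized by an open set
    of R^(2n). *)
Lemma meager_secants K (a b : M -> 'rV[R]_(1 + K)) : compact [set: M] ->
  smfun a -> smfun b -> (n + n < K + K)%N ->
  meager [set u | exists p q, sqmod (a p - a q) (b p - b q) != 0 /\
    u = slope (a p - a q) (b p - b q)].
Proof.
move=> cM sa sb nK.
pose S (A B : set M) := [set u | exists p q, [/\ A p, B q, sqmod (a p - a q) (b p - b q) != 0 &
  u = slope (a p - a q) (b p - b q)]].
apply: (@meager_sub _ _ _ (S setT setT)).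
  by move=> u [p [q [h ->]]]; exists p, q.
apply: (@compact_ind M (fun A => meager (S A setT))) => //.
- by apply: meager_sub (meager0 _ _) => u [p [q []]].
- by move=> A B AB; apply: meager_sub => u [p [q [/AB Bp Tq h ->]]]; exists p, q.
- move=> A B mA mB; apply: meager_sub (meagerU mA mB).
  by move=> u [p [q [[Ap|Bp] Tq h ->]]]; [left|right]; exists p, q.
move=> p0 _; have [i ip0] := mcover p0; exists (dom i); first exact: near_dom.
apply: (@compact_ind M (fun B => meager (S (dom i) B))) => //.
- by apply: meager_sub (meager0 _ _) => u [p [q []]].
- by move=> A B AB; apply: meager_sub => u [p [q [Ap /AB Bq h ->]]]; exists p, q.
- move=> A B mA mB; apply: meager_sub (meagerU mA mB).
  by move=> u [p [q [ip [Aq|Bq] h ->]]]; [left|right]; exists p, q.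
move=> q0 _; have [j jq0] := mcover q0; exists (dom j); first exact: near_dom.
have cl : continuous (lsubmx : 'rV[R]_(n + n) -> 'rV[R]_n) by exact: linear_mx_continuous.
have cr : continuous (rsubmx : 'rV[R]_(n + n) -> 'rV[R]_n) by exact: linear_mx_continuous.
pose W : set 'rV[R]_(n + n) := lsubmx @^-1` cod i `&` rsubmx @^-1` cod j.
have oW : open W.
  by apply: openI; apply: open_comp => //; exact: ccod_open.
have sl : smooth_on W (lsubmx : 'rV[R]_(n + n) -> 'rV[R]_n) by exact: smooth_on_linear.
have sr : smooth_on W (rsubmx : 'rV[R]_(n + n) -> 'rV[R]_n) by exact: smooth_on_linear.
have sW (f : M -> 'rV[R]_(1 + K)) : smfun f ->
    smooth_on W (fun z => in_chart i f (lsubmx z) - in_chart j f (rsubmx z)).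
  have Wl : W `<=` lsubmx @^-1` cod i by move=> z [].
  have Wr : W `<=` rsubmx @^-1` cod j by move=> z [].
  move=> sf; apply: smooth_onB => //.
    exact: (smooth_on_comp_mx oW (@ccod_open _ _ _ (mchart i)) Wl sl (sf i)).
  exact: (smooth_on_comp_mx oW (@ccod_open _ _ _ (mchart j)) Wr sr (sf j)).
apply: meager_sub (meager_slope nK oW (sW a sa) (sW b sb)) => u [p [q [ip jq h ->]]].
exists (row_mx (phi i p) (phi j q)).
rewrite row_mxKl row_mxKr /in_chart !cmapK//; split=> //.
by split; rewrite /= ?row_mxKl ?row_mxKr; exact: cod_phi.
Qed.

(** In a chart, the vectors df (v) - t i df (J v) are parametrized by the point,
    [v] and [t], in an open set of R^(n + (n + 1)).  By chart independence one
    chart around each point suffices. *)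
Lemma meager_tangents K (a b : M -> 'rV[R]_(1 + K)) : compact [set: M] ->
  smfun a -> smfun b -> (n + (n + 1) < K + K)%N ->
  meager [set u | exists i p t v, [/\ dom i p,
    sqmod (re_deform a b i p t v) (im_deform a b i p t v) != 0 &
    u = slope (re_deform a b i p t v) (im_deform a b i p t v)]].
Proof.
move=> cM sa sb nK.
pose S (A : set M) := [set u | exists i p t v, [/\ A p, dom i p,
    sqmod (re_deform a b i p t v) (im_deform a b i p t v) != 0 &
    u = slope (re_deform a b i p t v) (im_deform a b i p t v)]].
apply: (@meager_sub _ _ _ (S setT)).
  by move=> u [i [p [t [v [ip h ->]]]]]; exists i, p, t, v.
apply: (@compact_ind M (fun A => meager (S A))) => //.
- by apply: meager_sub (meager0 _ _) => u [i [p [t [v []]]]].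
- by move=> A B AB; apply: meager_sub => u [i [p [t [v [/AB Bp ip h ->]]]]]; exists i, p, t, v.
- move=> A B mA mB; apply: meager_sub (meagerU mA mB).
  by move=> u [i [p [t [v [[Ap|Bp] ip h ->]]]]]; [left|right]; exists i, p, t, v.
move=> p0 _; have [j jp0] := mcover p0; exists (dom j); first exact: near_dom.
pose X (z : 'rV[R]_(n + (n + 1))) : 'rV[R]_n := lsubmx z.
pose V (z : 'rV[R]_(n + (n + 1))) : 'rV[R]_n := lsubmx (rsubmx z).
pose T (z : 'rV[R]_(n + (n + 1))) : R := rsubmx (rsubmx z) ord0 ord0.
pose W := X @^-1` cod j.
have oC := @ccod_open _ _ _ (mchart j).
have oW : open W.
  apply: open_comp => // z _; exact: linear_mx_continuous.
have XW : W `<=` X @^-1` cod j by [].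
have sX : smooth_on W X.
  exact: (smooth_on_linear oW (lsubmx : {linear 'rV[R]_(n + (n + 1)) -> 'rV[R]_n})).
have sr : smooth_on W (rsubmx : 'rV[R]_(n + (n + 1)) -> 'rV[R]_(n + 1)).
  exact: smooth_on_linear.
have sV : smooth_on W V.
  exact: (smooth_on_comp_mx oW openT (@subsetT _ _) sr
    (smooth_on_linear openT (lsubmx : {linear 'rV[R]_(n + 1) -> 'rV[R]_n}))).
have sT : smooth_on W T.
  have h : smooth_on W (rsubmx \o (rsubmx : 'rV[R]_(n + (n + 1)) -> 'rV[R]_(n + 1))).
    exact: (smooth_on_comp_mx oW openT (@subsetT _ _) sr
      (smooth_on_linear openT (rsubmx : {linear 'rV[R]_(n + 1) -> 'rV[R]_1}))).
  exact: (smooth_on_mxP _ oW).1 h ord0 ord0.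
have sP (f : 'rV[R]_n -> 'M[R]_(n, 1 + K)) : smooth_on (cod j) f -> smooth_on W (fun z => f (X z)).
  by move=> sf; exact: (smooth_on_comp_mx oW oC XW sX sf).
have sJ : smooth_on W (fun z => acs J j (psi j (X z))).
  exact: (smooth_on_comp_mx oW oC XW sX (acs_smooth J j)).
have sja := sP _ (smooth_on_jacobian oC (sa j)).
have sjb := sP _ (smooth_on_jacobian oC (sb j)).
pose wa z := V z *m jacobian (in_chart j a) (X z) + T z *: (V z *m J j (psi j (X z)) *m jacobian (in_chart j b) (X z)).
pose wb z := V z *m jacobian (in_chart j b) (X z) - T z *: (V z *m J j (psi j (X z)) *m jacobian (in_chart j a) (X z)).
have swa : smooth_on W wa.
  exact: (smooth_onD oW (smooth_on_mulmx oW sV sja)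
    (smooth_onZ oW sT (smooth_on_mulmx oW (smooth_on_mulmx oW sV sJ) sjb))).
have swb : smooth_on W wb.
  exact: (smooth_onB oW (smooth_on_mulmx oW sV sjb)
    (smooth_onZ oW sT (smooth_on_mulmx oW (smooth_on_mulmx oW sV sJ) sja))).
apply: meager_sub (meager_slope nK oW swa swb) => u [i [p [t [v [jp ip]]]]].
rewrite (re_deform_transition t v sa sb ip jp) (im_deform_transition t v sa sb ip jp).
move: ('d (transition i j) (phi i p) v) => w h ->.
exists (row_mx (phi j p) (row_mx w t%:M)).
have XE : X (row_mx (phi j p) (row_mx w t%:M)) = phi j p by rewrite /X row_mxKl.
have VE : V (row_mx (phi j p) (row_mx w t%:M)) = w by rewrite /V row_mxKr row_mxKl.
have TE : T (row_mx (phi j p) (row_mx w t%:M)) = t by rewrite /T !row_mxKr mxE mulr1n.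
rewrite /wa /wb /W /= XE VE TE !cmapK//; split=> //; exact: cod_phi.
Qed.

(** Multiplication of a + i b by a constant complex matrix A - i B commutes with
    the formation of df (v) - t i df (J v). *)
Lemma re_deform_lin K K' (a b : M -> 'rV[R]_K) (A B : 'M[R]_(K, K')) i p t v :
  smfun a -> smfun b -> dom i p ->
  re_deform (fun p => a p *m A + b p *m B) (fun p => b p *m A + a p *m (- B)) i p t v =
  re_deform a b i p t v *m A + im_deform a b i p t v *m B.
Proof.
move=> sa sb ip.
apply: (etrans (congr2 (fun x y => x + t *: y) (jacobian_lin A B v sa sb ip)
  (jacobian_lin A (- B) (v *m J i p) sb sa ip))).
exact: mulmx_re.
Qed.

Lemma im_deform_lin K K' (a b : M -> 'rV[R]_K) (A B : 'M[R]_(K, K')) i p t v :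
  smfun a -> smfun b -> dom i p ->
  im_deform (fun p => a p *m A + b p *m B) (fun p => b p *m A + a p *m (- B)) i p t v =
  im_deform a b i p t v *m A - re_deform a b i p t v *m B.
Proof.
move=> sa sb ip.
apply: (etrans (congr2 (fun x y => x - t *: y) (jacobian_lin A (- B) v sb sa ip)
  (jacobian_lin A B (v *m J i p) sa sb ip))).
exact: mulmx_im.
Qed.

Lemma generic_pair_project K (a b : M -> 'rV[R]_(1 + K)) : compact [set: M] ->
  (n < K)%N -> generic_pair a b -> exists a' b' : M -> 'rV[R]_K, generic_pair a' b'.
Proof.
move=> cM nK [sa sb iab tab].
have nK1 : (n + n < K + K)%N by lia.
have nK2 : (n + (n + 1) < K + K)%N by lia.
have [u nu] := meager_avoid (meagerU (meager_secants cM sa sb nK1)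
  (meager_tangents cM sa sb nK2)).
exists (fun p => a p *m projA u + b p *m projB u),
       (fun p => b p *m projA u + a p *m (- projB u)).
split.
- exact: smfun_lin.
- exact: smfun_lin.
- move=> p q ha hb.
  have [||[ea eb]|[r0 uE]] := @proj_kernel _ _ (a p - a q) (b p - b q) u.
  + by rewrite !mulmxBl addrACA ha -opprD subrr.
  + move: hb; rewrite !mulmxN !mulmxBl => hb.
    by rewrite opprD addrACA hb -opprD subrr.
  + by apply: iab; apply/eqP; rewrite -subr_eq0; apply/eqP.
  + by case: nu; left; exists p, q.
- move=> i p t v ip; rewrite re_deform_lin// im_deform_lin// => h1 h2.
  have [[e1 e2]|[r0 uE]] := proj_kernel h1 h2.
    exact: tab ip e1 e2.
  by case: nu; right; exists i, p, t, v.
Qed.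

(** For a real embedding g the real part of dg (v) - t i dg (J v) is dg (v).  The
    [K] zero coordinates let the later projections end in dimension [K] whatever
    [L] is. *)
Lemma generic_pair_pad L (g : M -> 'rV[R]_L) K : embeds_on setT g ->
  exists a b : M -> 'rV[R]_(L + K), generic_pair a b.
Proof.
move=> [sg ig dg].
have s0 k : smfun (fun _ : M => 0 : 'rV[R]_k) by move=> i; exact: smooth_on_cst.
exists (fun p => row_mx (g p) 0), (fun=> 0).
have sa : smfun (fun p => row_mx (g p) (0 : 'rV[R]_K)).
  by move=> i; apply: smooth_on_row_mx; [exact: ccod_open|exact: sg|exact: smooth_on_cst].
split=> //.
- by move=> p q /eq_row_mx[gpq _] _; exact: ig gpq.
- move=> i p t v ip h _; apply: (dg p i) => //.
  have db : 'd (in_chart i (fun _ : M => 0 : 'rV[R]_(L + K))) (phi i p) (v *m J i p) = 0.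
    exact: (@diff_cst0 _ _ _ (0 : 'rV[R]_(L + K))).
  have h0 : 'd (in_chart i (fun p => row_mx (g p) (0 : 'rV[R]_K))) (phi i p) v = 0.
    apply: etrans _ h; rewrite /re_deform.
    have e1 := mul_jacobian v (smfun_differentiable sa ip).
    have e2 := etrans (mul_jacobian (v *m J i p) (smfun_differentiable (s0 _) ip)) db.
    apply: esym; apply: (etrans (congr2 (fun x y => x + t *: y) e1 e2)).
    by rewrite scaler0 addr0.
  have := etrans (esym (diff_in_chart_row_mx v sg (s0 K) ip)) h0.
  by rewrite -[X in _ = X -> _](@row_mx0 _ 1 L K) => /eq_row_mx[].
Qed.

Lemma generic_pair_exists K : compact [set: M] -> (n < K)%N ->
  exists a b : M -> 'rV[R]_K, generic_pair a b.
Proof.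
move=> cM nK; have [L [g Eg]] := embedding_exists cM.
have [a [b]] := generic_pair_pad K Eg.
elim: L {g Eg} a b => [|L IH] a b ab; first by exists a, b.
have nLK : (n < L + K)%N by exact: ltn_addl.
have [a' [b' ab']] := generic_pair_project cM nLK ab.
exact: IH ab'.
Qed.
End GenericPair.

(** * Extension of smooth functions from an embedded compact manifold *)

Lemma compact_embedding (T S : topologicalType) (f : T -> S) :
  compact [set: T] -> hausdorff_space S -> continuous f -> injective f ->
  topological_embedding f.
Proof.
move=> cT hS cf injf; split=> // U oU; exists (~` (f @` (~` U))).
  apply: closed_openC; apply: compact_closed => //; apply: continuous_compact.
    exact: continuous_subspaceT.
  by apply: subclosed_compact cT _ => //; exact: open_closedC.
apply/seteqP; split=> [y [p Up <-]|y [nUp [p _ fp]]].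
  by split; [move=> [q nUq /injf qp]; apply: nUq; rewrite qp|exists p].
by exists p => //; apply: contrapT => nU; apply: nUp; exists p.
Qed.

Section Extension.
Variables (R : realType) (n : nat) (M : smoothManifold R n).
Variables (N r s : nat) (f : M -> 'rV[R]_N) (E : M -> 'M[R]_(r, s)) (e : R).
Hypotheses (cM : compact [set: M]) (ef : embeds_on setT f) (sE : smfun E).
Hypotheses (e0 : 0 <= e) (Ee : forall p, `|E p| <= e).

Local Notation dom i := (cdom (mchart i)).
Local Notation cod i := (ccod (mchart i)).
Local Notation phi i := (cmap (mchart i)).
Local Notation psi i := (cinv (mchart i)).

(** The local left inverse of an immersion is followed by the inverse of the
    chart; since [f] is an embedding, the neighbourhood of [f p] can be shrunk to
    meet the image of [f] only in points of that chart. *)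
Lemma local_retraction (p : M) : exists V (h : 'rV[R]_N -> M),
  [/\ open V, V (f p), smooth_on V (E \o h) & forall q, V (f q) -> h (f q) = q].
Proof.
have [sf ijf df] := ef; have [i ip] := mcover p.
have fE : topological_embedding f.
  apply: (compact_embedding cM (@norm_hausdorff _ _) (smfun_continuous sf)).
  by move=> q q'; exact: ijf.
have [U0 [V [h [[oU0 U0p U0i oV sh] [U0h hU0]]]]] :=
  immersion_left_inverse (@ccod_open _ _ _ (mchart i)) (cod_phi ip) (sf i)
    (fun v => df p i v I ip).
pose U1 := dom i `&` phi i @^-1` U0.
have oU1 : open U1.
  rewrite openE => q [iq U0q]; apply: filterI; first exact: near_dom.
  have := cmap_continuous iq; apply; exact: open_nbhs_nbhs.
have [_ _ /(_ U1 oU1)[V' oV' U1V']] := fE.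
have U1q q : V' (f q) -> U1 q.
  move=> V'q; have : (V' `&` range f) (f q) by split=> //; exists q.
  by rewrite -U1V' => -[q' U1q' /ijf <-].
exists (V `&` V'), (psi i \o h); split.
- exact: openI.
- split; first by have [] := U0h _ U0p; rewrite /in_chart cmapK.
  have : (f @` U1) (f p) by exists p.
  by rewrite U1V' => -[].
- apply: (@smooth_on_sub _ _ _ _ V); first exact: subIsetl.
  have hV : V `<=` h @^-1` cod i by move=> y /hU0 /U0i.
  exact: (smooth_on_comp_mx oV (@ccod_open _ _ _ (mchart i)) hV sh (sE i)).
- move=> q [Vq /U1q[iq U0q]]; have [_] := U0h _ U0q.
  by rewrite /in_chart /= cmapK// => ->; rewrite cmapK.
Qed.

Definition bounded_smooth (G : 'rV[R]_N -> 'M[R]_(r, s)) :=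
  smooth_on setT G /\ forall x, `|G x| <= e.

(** Near [f p] the extension [G] is replaced by [E \o h], with a cutoff [b]; where
    [G] was already correct it stays so, and values stay in the ball of radius
    [e], by convexity. *)
Lemma extension_step (p : M) : exists2 U, nbhs p U &
  forall G, bounded_smooth G -> exists G', [/\ bounded_smooth G',
    forall q, U q -> G' (f q) = E q &
    forall q, G (f q) = E q -> G' (f q) = E q].
Proof.
have [sf ijf df] := ef.
have [V [h [oV Vp sEh hf]]] := local_retraction p.
have [d d0 dV] : exists2 d, 0 < d & [set y | `|y - f p| <= d] `<=` V.
  by apply: nbhs_cball; exact: open_nbhs_nbhs.
have [b [sb b01 b1 bV]] := bump_exists (f p) d0.
exists (f @^-1` [set y | b y = 1]).
  by apply: (smfun_continuous sf).
move=> G [sG Ge].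
pose G' y := (1 - b y) *: G y + b y *: E (h y).
have VG' y : ~ V y -> b y = 0.
  by move=> nV; apply/eqP; apply: contra_notT nV => /bV /dV.
exists G'; split; first split.
- apply: smooth_onD; first exact: openT.
    apply: smooth_onZ => //; first exact: openT.
    apply: smooth_onD; first exact: openT; first exact: smooth_on_cst.
    by apply: smooth_onN => //; exact: openT.
  apply: smooth_on_local => y _; have [Vy|nVy] := pselect (V y).
    exists V => //; apply: smooth_onZ => //; exact: smooth_on_sub sb.
  pose W := ~` [set y | `|y - f p| <= d].
  exists W; first by move=> /dV.
  have oW : open W by apply: closed_openC; exact: closed_cball.
  apply: smooth_on_eq (smooth_on_cst W 0) => // z /set_mem Wz.
  rewrite (_ : b z = 0) ?scale0r//; apply/eqP; apply: contra_notT Wz; exact: bV.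
- move=> y; have /andP[b0 b1y] := b01 y.
  apply: le_trans (ler_normD _ _) _; rewrite !normrZ !ger0_norm ?subr_ge0//.
  apply: le_trans (lerD (ler_wpM2l _ (Ge y)) (ler_wpM2l _ (Ee _))) _.
  - by rewrite subr_ge0.
  - exact: b0.
  by rewrite -mulrDl subrK mul1r.
- move=> q bq.
  have Vq : V (f q) by apply/dV/bV; rewrite bq oner_eq0.
  by rewrite /G' bq subrr scale0r add0r scale1r hf.
- move=> q Gq; rewrite /G' Gq.
  have [Vq|/VG' ->] := pselect (V (f q)); last by rewrite subr0 scale1r scale0r addr0.
  by rewrite hf// -scalerDl subrK scale1r.
Qed.

Lemma smooth_extension : exists G : 'rV[R]_N -> 'M[R]_(r, s),
  [/\ smooth_on setT G, forall x, `|G x| <= e & forall p, G (f p) = E p].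
Proof.
(* P is phrased as the improvement of an arbitrary G on A, so that it passes to
   unions by two successive improvements. *)
pose P (A : set M) := forall G, bounded_smooth G -> exists G', [/\ bounded_smooth G',
    forall q, A q -> G' (f q) = E q &
    forall q, G (f q) = E q -> G' (f q) = E q].
have : P setT.
  apply: (@compact_ind M P) => //.
  - by move=> G bG; exists G.
  - move=> A B AB PB G /PB[G' [bG' BG' GG']]; exists G'; split=> //.
    by move=> q /AB; exact: BG'.
  - move=> A B PA PB G /PA[G' [/PB[G'' [bG'' BG'' G'G'']] AG' GG']].
    exists G''; split=> //.
      by move=> q [/AG'|/BG''//]; exact: G'G''.
    by move=> q /GG'; exact: G'G''.
  - by move=> p _; exact: extension_step.
move=> /(_ (fun=> 0)) [|G [[sG Ge] GE _]].
  by split; [exact: smooth_on_cst|move=> x; rewrite normr0].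
by exists G; split=> // p; exact: GE.
Qed.
End Extension.

(** * The standard complex structure on R^(2K) *)

Section Interleave.
Variables (R : realType) (K : nat).

(** (x, y) |-> x *m evenmx + y *m oddmx interleaves the coordinates of [x] and [y].
    In these coordinates [stdJ] is (x, y) |-> (- y, x), multiplication of x + i y
    by i. *)
Definition evenmx : 'M[R]_(K, K.*2) := \matrix_(k, j) (j == k.*2 :> nat)%:R.
Definition oddmx : 'M[R]_(K, K.*2) := \matrix_(k, j) (j == k.*2.+1 :> nat)%:R.
Definition stdJ : 'M[R]_(K.*2) := evenmx^T *m oddmx - oddmx^T *m evenmx.

Lemma even_even : evenmx *m evenmx^T = 1%:M.
Proof.
apply/matrixP => k l; rewrite !mxE.
have lt : (k.*2 < K.*2)%N by rewrite ltn_double.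
rewrite (bigD1 (Ordinal lt))//= !mxE eqxx mul1r big1 ?addr0.
  by congr (_%:R); rewrite -[(_ == l.*2)%N]/((k.*2 == l.*2)%N) (inj_eq double_inj).
by move=> j; rewrite -val_eqE /= !mxE => /negPf ->; rewrite mul0r.
Qed.

Lemma odd_odd : oddmx *m oddmx^T = 1%:M.
Proof.
apply/matrixP => k l; rewrite !mxE.
have lt : (k.*2.+1 < K.*2)%N by rewrite ltn_Sdouble.
rewrite (bigD1 (Ordinal lt))//= !mxE eqxx mul1r big1 ?addr0.
  by congr (_%:R); rewrite eqSS (inj_eq double_inj).
by move=> j; rewrite -val_eqE /= !mxE => /negPf ->; rewrite mul0r.
Qed.

Lemma even_odd : evenmx *m oddmx^T = 0.
Proof.
apply/matrixP => k l; rewrite !mxE big1// => j _; rewrite !mxE.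
have [->|] := eqVneq (j : nat) k.*2; last by rewrite mul0r.
rewrite (_ : (_ == _) = false) ?mulr0//.
by apply/negP => /eqP /(congr1 odd); rewrite /= !odd_double.
Qed.

Lemma odd_even : oddmx *m evenmx^T = 0.
Proof. by rewrite -[LHS]trmxK trmx_mul trmxK even_odd trmx0. Qed.

Lemma even_odd_split : evenmx^T *m evenmx + oddmx^T *m oddmx = 1%:M.
Proof.
apply/matrixP => i j; rewrite !mxE.
have iK : (i./2 < K)%N by rewrite ltn_half_double.
rewrite (bigD1 (Ordinal iK))//= [X in _ + X](bigD1 (Ordinal iK))//= !mxE.
rewrite !big1 ?addr0; last 2 first.
- move=> k; rewrite -val_eqE /= !mxE => ki.
  rewrite (_ : (_ == _.*2.+1) = false) ?mul0r//.
  by apply: contraNF ki => /eqP ->; rewrite /= uphalf_double.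
- move=> k; rewrite -val_eqE /= !mxE => ki.
  rewrite (_ : (_ == _.*2) = false) ?mul0r//.
  by apply: contraNF ki => /eqP ->; rewrite doubleK.
rewrite /= -(inj_eq val_inj) /=.
case: (boolP (odd i)) => oi.
  have -> : (nat_of_ord i == i./2.*2) = false by lia.
  have -> : i./2.*2.+1 = i by lia.
  by rewrite eqxx mul0r add0r mul1r eq_sym.
have -> : (nat_of_ord i == i./2.*2.+1) = false by lia.
have -> : i./2.*2 = i by lia.
by rewrite eqxx mul0r addr0 mul1r eq_sym.
Qed.

Lemma even_stdJ : evenmx *m stdJ = oddmx.
Proof. by rewrite mulmxBr !mulmxA even_even even_odd mul1mx mul0mx subr0. Qed.

Lemma odd_stdJ : oddmx *m stdJ = - evenmx.
Proof. by rewrite mulmxBr !mulmxA odd_even odd_odd mul1mx mul0mx sub0r. Qed.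

Lemma stdJ_sqr : stdJ *m stdJ = - 1%:M.
Proof.
rewrite {1}/stdJ mulmxBl -!mulmxA odd_stdJ even_stdJ mulmxN -opprD.
by rewrite even_odd_split.
Qed.

Lemma stdJ_frame_commutes (V : 'M[R]_(K, K.*2)) :
  (evenmx^T *m V + oddmx^T *m (V *m stdJ)) *m stdJ =
  stdJ *m (evenmx^T *m V + oddmx^T *m (V *m stdJ)).
Proof.
have : V *m stdJ *m stdJ = - V by rewrite -mulmxA stdJ_sqr mulmxN mulmx1.
rewrite mulmxDl -(mulmxA _ V) -(mulmxA _ (V *m stdJ)).
move: (V *m stdJ) => W ->; rewrite /stdJ mulmxDr !mulmxBl -!mulmxA.
rewrite !(mulmxA evenmx) !(mulmxA oddmx) even_even odd_odd even_odd odd_even.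
by rewrite !mul0mx !mul1mx !mulmx0 sub0r subr0 addrC mulmxN.
Qed.

(** The left-hand side is the frame in the definition of positivity. *)
Lemma frame_split (V : nat -> 'rV[R]_(K.*2)) (A : 'M[R]_(K.*2)) :
  \matrix_(k < K.*2) (if odd k then V k./2 *m A else V k./2) =
  evenmx^T *m (\matrix_(k < K) V k) + oddmx^T *m ((\matrix_(k < K) V k) *m A).
Proof.
set W := \matrix_(k < K) V k.
have iK (k : 'I_(K.*2)) : (k./2 < K)%N by rewrite ltn_half_double.
have WE k : row (Ordinal (iK k)) W = V k./2 by rewrite rowK.
apply/row_matrixP => k; rewrite rowK linearD /= !row_mul.
have rE : row k evenmx^T = if odd k then 0 else delta_mx 0 (Ordinal (iK k)).
  apply/rowP => l; rewrite !mxE; case: ifP => ok; rewrite !mxE.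
    by have -> : (nat_of_ord k == l.*2) = false by lia.
  rewrite eqxx -val_eqE /=; congr (_%:R); congr nat_of_bool; lia.
have rO : row k oddmx^T = if odd k then delta_mx 0 (Ordinal (iK k)) else 0.
  apply/rowP => l; rewrite !mxE; case: ifP => ok; rewrite !mxE.
    rewrite eqxx -val_eqE /=; congr (_%:R); congr nat_of_bool; lia.
  by have -> : (nat_of_ord k == l.*2.+1) = false by lia.
rewrite rE rO; case: ifP => ok; rewrite mul0mx ?add0r ?addr0 -?rowE ?row_mul WE //.
Qed.
End Interleave.

(** * Twisting the standard structure by a map to matrices of positive determinant *)

Section Twisted.
Variables (R : realType) (K : nat).
Local Notation N := (K.*2).
Variable P : 'rV[R]_N -> 'M[R]_N.
Hypotheses (sP : smooth_on setT P) (dP : forall x, 0 < \det (P x)).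

Definition twisted (x : 'rV[R]_N) : 'M[R]_N := P x *m stdJ R K *m invmx (P x).

Lemma unit_twist x : P x \in unitmx.
Proof. by rewrite unitmxE unitfE gt_eqF. Qed.

Lemma twisted_smooth : smooth_on setT twisted.
Proof.
have sV := smooth_on_invmx openT (fun x _ => unit_twist x) sP.
exact: (smooth_on_mulmx openT (smooth_on_mulmx openT sP (smooth_on_cst _ _)) sV).
Qed.

Lemma twisted_sqr x : twisted x *m twisted x = - 1%:M.
Proof.
rewrite /twisted !mulmxA mulmxKV ?unit_twist// -(mulmxA (P x)) stdJ_sqr.
by rewrite mulmxN mulmx1 mulNmx mulmxV ?unit_twist.
Qed.

Lemma euclidean_tangent_id (i j : mindex (euclidean R N)) (p : euclidean R N) v :
  tangent_map i j (id : euclidean R N -> euclidean R N) p v = v.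
Proof.
rewrite /tangent_map /coord_rep /=.
by have -> : 'd (fun x : 'rV[R]_N => x) p = id :> (_ -> _) by exact: diff_val.
Qed.

Lemma twisted_tensor (i j : mindex (euclidean R N)) (p : euclidean R N) :
  cdom (mchart i) p -> cdom (mchart j) p ->
  forall v, tangent_map i j (id : euclidean R N -> euclidean R N) p (v *m twisted p) =
            tangent_map i j (id : euclidean R N -> euclidean R N) p v *m twisted p.
Proof. by move=> _ _ v; rewrite !euclidean_tangent_id. Qed.

Definition twisted_acs : almostComplex (euclidean R N) :=
  @AlmostComplex R N (euclidean R N) (fun _ x => twisted x)
    (fun _ => twisted_smooth) twisted_tensor (fun _ x _ => twisted_sqr x).

(** If the rows of [B] are v_0, v_0 J', v_1, v_1 J', ... for the twisted structure
    J' = P J P^-1, those of [B P] are w_0, w_0 J, w_1, w_1 J, ... with w = v P; so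
    [B P] commutes with [stdJ] and has a nonnegative determinant. *)
Lemma twisted_positive : positive_acs (standard_orientation R N) twisted_acs.
Proof.
move=> i p _ v B; rewrite unitmxE unitfE => dB.
have BE : B = (evenmx R K)^T *m (\matrix_(k < K) v k) +
    (oddmx R K)^T *m ((\matrix_(k < K) v k) *m twisted p) by exact: frame_split.
have BP : B *m P p = (evenmx R K)^T *m ((\matrix_(k < K) v k) *m P p) +
    (oddmx R K)^T *m ((\matrix_(k < K) v k) *m P p *m stdJ R K).
  by rewrite BE mulmxDl /twisted -!mulmxA mulVmx ?unit_twist// mulmx1.
have : 0 <= \det (B *m P p).
  apply: (det_commuting_ge0 (stdJ_sqr R K)); rewrite BP.
  exact: stdJ_frame_commutes.
rewrite det_mulmx pmulr_lge0// => B0.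
by rewrite lt_def B0 dB.
Qed.
End Twisted.

(** * Deforming an injective linear map to a complex linear one *)

Section RightInverse.
Variables (R : realType) (n N : nat).
Implicit Types (A G : 'M[R]_(n, N)).

(** The Moore-Penrose inverse of an injective linear map: a right inverse for row
    vectors that depends smoothly on [A]. *)
Definition rinv A : 'M[R]_(N, n) := A^T *m invmx (A *m A^T).

Lemma gram_unit A : (forall v : 'rV[R]_n, v *m A = 0 -> v = 0) -> A *m A^T \in unitmx.
Proof.
move=> iA; apply: inj_unitmx => v vAA; apply: iA.
have : (v *m A) *m (v *m A)^T = 0 by rewrite trmx_mul mulmxA -(mulmxA v) vAA mul0mx.
move: (v *m A) => w /(congr1 (fun X : 'M[R]_1 => X ord0 ord0)).
rewrite !mxE => /eqP; rewrite psumr_eq0 => [/allP h|i _]; last first.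
  by rewrite mxE -expr2 sqr_ge0.
apply/rowP => j; have := h j (mem_index_enum _).
by rewrite !mxE -expr2 sqrf_eq0 => /eqP.
Qed.

Lemma mulmx_rinv A : A *m A^T \in unitmx -> A *m rinv A = 1%:M.
Proof. by move=> uA; rewrite mulmxA mulmxV. Qed.

Lemma mulmx_rinv_step A G (c : R) : A *m A^T \in unitmx ->
  A *m (1%:M + c *: (rinv A *m G)) = A + c *: G.
Proof.
by move=> uA; rewrite mulmxDr mulmx1 -scalemxAr mulmxA mulmx_rinv// mul1mx.
Qed.

Lemma invmx_congruence (H T : 'M[R]_n) : T \in unitmx -> H \in unitmx ->
  T^T *m invmx (T *m H *m T^T) *m T = invmx H.
Proof.
move=> uT uH; apply: (can_inj (mulKmx uH)); rewrite mulmxV//.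
apply: (can_inj (mulKmx uT)); rewrite mulmx1 !mulmxA mulmxV ?mul1mx//.
by rewrite !unitmx_mul uT uH unitmx_tr uT.
Qed.

Lemma rinv_invariant A G (T : 'M[R]_n) : T \in unitmx -> A *m A^T \in unitmx ->
  rinv (T *m A) *m (T *m G) = rinv A *m G.
Proof.
move=> uT uA; rewrite /rinv -(invmx_congruence uT uA) trmx_mul.
by rewrite !mulmxA.
Qed.
End RightInverse.

Section Deformation.
Variables (R : realType) (n K : nat).
Local Notation N := (K.*2).

(** The matrix of v |-> D (v) - t i D (A v), for an endomorphism [A] in the role of
    the almost-complex structure. *)
Definition deform (D : 'M[R]_(n, N)) (A : 'M[R]_n) (t : R) : 'M[R]_(n, N) :=
  D - t *: (A *m D *m stdJ R K).

(** The logarithmic derivative of the deformation, up to sign: by [deform_step],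
    multiplication by [1 - c * deform_gen] moves time [t] to time [t + c].  It acts
    on R^(2K) only and does not depend on coordinates in the tangent space
    ([deform_gen_invariant]). *)
Definition deform_gen (D : 'M[R]_(n, N)) (A : 'M[R]_n) (t : R) : 'M[R]_N :=
  rinv (deform D A t) *m (A *m D *m stdJ R K).

Lemma deform_step D A t c : deform D A t *m (deform D A t)^T \in unitmx ->
  deform D A t *m (1%:M + (- c) *: deform_gen D A t) = deform D A (t + c).
Proof.
move=> u; rewrite mulmx_rinv_step// /deform scalerDl opprD addrA.
by rewrite scaleNr.
Qed.

Lemma deform_gen_invariant D A D' A' T t : T \in unitmx ->
  deform D' A' t *m (deform D' A' t)^T \in unitmx ->
  D = T *m D' -> A *m T = T *m A' -> deform_gen D A t = deform_gen D' A' t.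
Proof.
move=> uT uP -> AT; rewrite /deform_gen.
have e : A *m (T *m D') *m stdJ R K = T *m (A' *m D' *m stdJ R K).
  by rewrite mulmxA AT !mulmxA.
have -> : deform (T *m D') A t = T *m deform D' A' t.
  by rewrite /deform e (mulmxBr T D') -scalemxAr.
by rewrite e rinv_invariant.
Qed.

Lemma deform1_complex D A : A *m A = - 1%:M ->
  deform D A 1 *m stdJ R K = A *m deform D A 1.
Proof.
move=> A2; rewrite /deform scale1r (mulmxBl D) (mulmxBr A D) !mulmxA A2.
by rewrite -(mulmxA (A *m D) (stdJ R K)) stdJ_sqr mulmxN mulmx1 !mulNmx mul1mx !opprK addrC.
Qed.
End Deformation.

Section Steps.
Variables (R : realType) (N : nat) (G : nat -> 'rV[R]_N -> 'M[R]_N).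

Fixpoint step_prod (s : nat) (x : 'rV[R]_N) : 'M[R]_N :=
  if s is s'.+1 then step_prod s' x *m (1%:M + G s' x) else 1%:M.

Lemma step_prod_smooth s : (forall r, (r < s)%N -> smooth_on setT (G r)) ->
  smooth_on setT (step_prod s).
Proof.
elim: s => [|s IH] sG; first exact: smooth_on_cst.
have s1 : smooth_on setT (step_prod s) by apply: IH => r rs; apply: sG; exact: ltnW.
have s2 := smooth_onD openT (smooth_on_cst setT (1%:M : 'M[R]_N)) (sG s (ltnSn s)).
exact: (smooth_on_mulmx openT s1 s2).
Qed.

Lemma step_prod_det_gt0 s x : (forall r, (r < s)%N -> N%:R * `|G r x| < 1) ->
  0 < \det (step_prod s x).
Proof.
elim: s => [|s IH] sG; first by rewrite det1 ltr01.
rewrite /= det_mulmx mulr_gt0//; last exact/det_1add_gt0/sG.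
by apply: IH => r rs; apply: sG; exact: ltnW.
Qed.
End Steps.

(** * The almost-complex structure on R^(2K) *)

Lemma mulmx_ext (R : realType) r s (A B : 'M[R]_(r, s)) :
  (forall v : 'rV[R]_r, v *m A = v *m B) -> A = B.
Proof. by move=> AB; apply/row_matrixP => k; rewrite !rowE. Qed.

Lemma mulmx_conj (R : realType) n N (v : 'rV[R]_n) (D : 'M[R]_(n, N)) (A : 'M[R]_n)
    (P S : 'M[R]_N) : P \in unitmx -> D *m P *m S = A *m (D *m P) ->
  v *m D *m (P *m S *m invmx P) = v *m A *m D.
Proof.
move=> uP DPS; have DP : D *m (P *m S *m invmx P) = A *m D.
  by rewrite !mulmxA DPS -!mulmxA mulmxV// mulmx1.
by rewrite -!(mulmxA v) DP.
Qed.

Section Assembly.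
Variables (R : realType) (n : nat) (M : smoothManifold R n) (J : almostComplex M).
Variables (K : nat) (a b : M -> 'rV[R]_K).
Hypotheses (cM : compact [set: M]) (gab : generic_pair J a b).

Implicit Types (i j : mindex M) (p q : M) (v : 'rV[R]_n) (t : R).

Local Notation dom i := (cdom (mchart i)).
Local Notation cod i := (ccod (mchart i)).
Local Notation phi i := (cmap (mchart i)).
Local Notation psi i := (cinv (mchart i)).
Local Notation N := (K.*2).

Definition emb (p : M) : 'rV[R]_N := a p *m evenmx R K + b p *m oddmx R K.

Lemma emb_smfun : smfun emb.
Proof. by have [sa sb _ _] := gab; exact: smfun_lin. Qed.

Lemma emb_inj : injective emb.
Proof.
have [_ _ iab _] := gab; move=> p q pq; apply: iab.
  have := congr1 (mulmx^~ (evenmx R K)^T) pq.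
  by rewrite /= /emb !mulmxDl -!mulmxA even_even odd_even !mulmx0 !addr0 !mulmx1.
have := congr1 (mulmx^~ (oddmx R K)^T) pq.
by rewrite /= /emb !mulmxDl -!mulmxA even_odd odd_odd !mulmx0 !add0r !mulmx1.
Qed.

Definition emb_jac i (x : 'rV[R]_n) : 'M[R]_(n, N) := jacobian (in_chart i emb) x.

Definition emb_deform i p t := deform (emb_jac i (phi i p)) (J i p) t.

Lemma deform_split (xa xb ya yb : 'rV[R]_K) (t : R) :
  (xa *m evenmx R K + xb *m oddmx R K) -
    t *: ((ya *m evenmx R K + yb *m oddmx R K) *m stdJ R K) =
  (xa + t *: yb) *m evenmx R K + (xb - t *: ya) *m oddmx R K.
Proof.
rewrite mulmxDl -!mulmxA even_stdJ odd_stdJ mulmxN scalerBr.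
rewrite (mulmxDl xa) (mulmxBl xb) -!scalemxAl opprB addrA addrAC -!addrA.
by congr (_ + _); rewrite addrA [RHS]addrC.
Qed.

Lemma mul_emb_deform i p t v : dom i p ->
  v *m emb_deform i p t = re_deform J a b i p t v *m evenmx R K + im_deform J a b i p t v *m oddmx R K.
Proof.
move=> ip; have [sa sb _ _] := gab.
have e1 := jacobian_lin (evenmx R K) (oddmx R K) v sa sb ip.
have e2 := jacobian_lin (evenmx R K) (oddmx R K) (v *m J i p) sa sb ip.
rewrite /emb_deform /deform (mulmxBr v) -scalemxAr !mulmxA.
apply: (etrans (congr2 (fun x y => x - t *: (y *m stdJ R K)) e1 e2)).
exact: deform_split.
Qed.

Lemma emb_deform_inj i p t (v : 'rV[R]_n) : dom i p -> v *m emb_deform i p t = 0 -> v = 0.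
Proof.
move=> ip; rewrite mul_emb_deform//; have [_ _ _ tab] := gab => h.
apply: (tab i p t v ip).
  have := congr1 (mulmx^~ (evenmx R K)^T) h.
  by rewrite /= mulmxDl -!mulmxA even_even odd_even mulmx0 addr0 mulmx1 mul0mx.
have := congr1 (mulmx^~ (oddmx R K)^T) h.
by rewrite /= mulmxDl -!mulmxA even_odd odd_odd mulmx0 add0r mulmx1 mul0mx.
Qed.

Lemma emb_deform_unit i p t : dom i p -> emb_deform i p t *m (emb_deform i p t)^T \in unitmx.
Proof. by move=> ip; apply: gram_unit => v; exact: emb_deform_inj. Qed.

Lemma emb_deform0 i p : emb_deform i p 0 = emb_jac i (phi i p).
Proof. by rewrite /emb_deform /deform scale0r subr0. Qed.

Lemma emb_diff i p v : dom i p -> 'd (in_chart i emb) (phi i p) v = v *m emb_jac i (phi i p).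
Proof. by move=> ip; exact/esym/mul_jacobian/(smfun_differentiable emb_smfun ip). Qed.

Lemma emb_embeds : embeds_on setT emb.
Proof.
split; [exact: emb_smfun|by move=> p q _; exact: emb_inj|].
move=> p i v _ ip; rewrite emb_diff// -emb_deform0; exact: emb_deform_inj.
Qed.

Definition emb_gen i (x : 'rV[R]_n) t : 'M[R]_N := deform_gen (emb_jac i x) (J i (psi i x)) t.

Lemma emb_gen_phi i p t : dom i p ->
  emb_gen i (phi i p) t = deform_gen (emb_jac i (phi i p)) (J i p) t.
Proof. by move=> ip; rewrite /emb_gen (cmapK ip). Qed.

Lemma transition_jacobian i j p v : dom i p -> dom j p ->
  'd (transition i j) (phi i p) v = v *m jacobian (transition i j) (phi i p).
Proof. by move=> ip jp; exact/esym/mul_jacobian/transition_differentiable. Qed.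

Lemma emb_gen_transition i j p t : dom i p -> dom j p -> emb_gen i (phi i p) t = emb_gen j (phi j p) t.
Proof.
move=> ip jp; apply: (etrans (emb_gen_phi t ip)); apply: etrans (esym (emb_gen_phi t jp)).
apply: (@deform_gen_invariant _ _ _ _ _ _ _ (jacobian (transition i j) (phi i p))).
- apply: inj_unitmx => v; rewrite -transition_jacobian//; exact: tangent_id_inj.
- exact: (@emb_deform_unit j p t jp).
- apply: mulmx_ext => v; apply: etrans (jacobian_in_chart_transition v emb_smfun ip jp) _.
  apply: etrans (esym (mulmxA v _ _)).
  exact: (congr1 (mulmx^~ (emb_jac j (phi j p))) (transition_jacobian v ip jp)).
- apply: mulmx_ext => v; apply: etrans (mulmxA v _ _) _; apply: etrans (esym (mulmxA v _ _)).
  apply: etrans (esym (transition_jacobian (v *m J i p) ip jp)) _.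
  apply: (etrans (acs_tensor J ip jp v)).
  exact: (congr1 (mulmx^~ (J j p)) (transition_jacobian v ip jp)).
Qed.

(** Time is one more coordinate, so that smoothness in [x] and boundedness in
    ([x], [t]) both follow from smoothness of a single map. *)
Definition emb_gen2 i (z : 'rV[R]_(n + 1)) : 'M[R]_N := emb_gen i (lsubmx z) (rsubmx z ord0 ord0).

Lemma emb_gen2_row_mx i x t : emb_gen2 i (row_mx x t%:M) = emb_gen i x t.
Proof. by rewrite /emb_gen2 row_mxKl row_mxKr mxE mulr1n. Qed.

Lemma emb_gen2_smooth i : smooth_on (lsubmx @^-1` cod i : set 'rV[R]_(n + 1)) (emb_gen2 i).
Proof.
set W : set 'rV[R]_(n + 1) := _ @^-1` _.
have oC := @ccod_open _ _ _ (mchart i).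
have oW : open W by apply: open_comp => // z _; exact: linear_mx_continuous.
have sl := smooth_on_linear oW (lsubmx : {linear 'rV[R]_(n + 1) -> 'rV[R]_n}).
have sr := smooth_on_linear oW (rsubmx : {linear 'rV[R]_(n + 1) -> 'rV[R]_1}).
have sT := (smooth_on_mxP _ oW).1 sr ord0 ord0.
have WC : W `<=` lsubmx @^-1` cod i by [].
have sD := smooth_on_comp_mx oW oC WC sl (smooth_on_jacobian oC (emb_smfun i)).
have sA := smooth_on_comp_mx oW oC WC sl (acs_smooth J i).
have sS := smooth_on_mulmx oW (smooth_on_mulmx oW sA sD) (smooth_on_cst W (stdJ R K)).
have sP := smooth_onB oW sD (smooth_onZ oW sT sS).
have sPt := smooth_on_trmx oW sP.
have uW z : W z -> deform (emb_jac i (lsubmx z)) (J i (psi i (lsubmx z))) (rsubmx z ord0 ord0) *m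
    (deform (emb_jac i (lsubmx z)) (J i (psi i (lsubmx z))) (rsubmx z ord0 ord0))^T \in unitmx.
  move=> Wz; have := @emb_deform_unit i (psi i (lsubmx z)) (rsubmx z ord0 ord0) (cinv_cdom Wz).
  by rewrite /emb_deform (cinvK Wz).
have sI := smooth_on_invmx oW uW (smooth_on_mulmx oW sP sPt).
exact: (smooth_on_mulmx oW (smooth_on_mulmx oW sPt sI) sS).
Qed.

Lemma emb_gen_smooth i t : smooth_on (cod i) (fun x => emb_gen i x t).
Proof.
have oC := @ccod_open _ _ _ (mchart i).
pose W : set 'rV[R]_(n + 1) := lsubmx @^-1` cod i.
have oW : open W by apply: open_comp => // z _; exact: linear_mx_continuous.
have sz : smooth_on (cod i) (fun x : 'rV[R]_n => row_mx x t%:M : 'rV[R]_(n + 1)).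
  by apply: smooth_on_row_mx => //; [exact: smooth_on_id|exact: smooth_on_cst].
have CW : cod i `<=` (fun x : 'rV[R]_n => row_mx x t%:M : 'rV[R]_(n + 1)) @^-1` W.
  by move=> x ix; rewrite /W /= row_mxKl.
apply: (smooth_on_eq oC _ (smooth_on_comp_mx oC oW CW sz (@emb_gen2_smooth i))) => x _.
exact: emb_gen2_row_mx.
Qed.

Lemma emb_gen_locally_bounded j p0 t0 : dom j p0 ->
  exists U B C, [/\ nbhs p0 U, nbhs t0 B &
    forall p t, U p -> B t -> dom j p /\ `|emb_gen j (phi j p) t| <= C].
Proof.
move=> jp0; pose z0 : 'rV[R]_(n + 1) := row_mx (phi j p0) t0%:M.
have Wz0 : (lsubmx @^-1` cod j : set 'rV[R]_(n + 1)) z0.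
  by rewrite /= row_mxKl; exact: cod_phi.
have c0 := smooth_on_continuous (@emb_gen2_smooth j) Wz0.
move/cvgrPdist_lt: c0 => /(_ _ ltr01) /nbhs_ballP[d /= d0 hd].
exists (dom j `&` phi j @^-1` ball (phi j p0) d), (ball t0 d), (`|emb_gen2 j z0| + 1).
split; [|exact: nbhsx_ballx|].
  apply: filterI; first exact: near_dom.
  by have := cmap_continuous jp0; apply; exact: nbhsx_ballx.
move=> p t [jp bp] bt; split=> //.
have /hd : ball z0 d (row_mx (phi j p) t%:M).
  split=> // k l; rewrite /z0 !mxE; case: (fintype.split l) => l'.
    by have [_] := bp; exact.
  by rewrite !mxE ord1 (ord1 l') !mulr1n.
rewrite (emb_gen2_row_mx j (phi j p) t).
move: (emb_gen2 j z0) (emb_gen j (phi j p) t) => A A' AA.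
have -> : A' = A - (A - A') by rewrite opprB addrC subrK.
by rewrite (le_trans (ler_normB _ _))// lerD2l ltW.
Qed.

Lemma emb_gen_bounded : exists C, forall i p t, dom i p -> 0 <= t <= 1 ->
  `|emb_gen i (phi i p) t| <= C.
Proof.
pose P (A : set M) := exists C, forall i p t, A p -> dom i p -> 0 <= t <= 1 ->
  `|emb_gen i (phi i p) t| <= C.
suff [C hC] : P setT by exists C => i p t; exact: hC.
apply: (@compact_ind M P) => //.
- by exists 0.
- by move=> A B AB [C hC]; exists C => i p t /AB; exact: hC.
- move=> A B [C hC] [D hD]; exists (Num.max C D) => i p t [Ap|Bp] ip t01.
    by rewrite le_max hC.
  by rewrite le_max hD ?orbT.
move=> p0 _; have [j jp0] := mcover p0.
pose P' (B : set R) := exists U C, nbhs p0 U /\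
  forall p t, U p -> B t -> dom j p /\ `|emb_gen j (phi j p) t| <= C.
have [U [C [p0U hC]]] : P' `[0, 1]%classic.
  apply: (@compact_ind R P'); last 2 first.
  - exact: segment_compact.
  - move=> t0 _; have [U [B [C [pU tB hC]]]] := emb_gen_locally_bounded t0 jp0.
    by exists B => //; exists U, C.
  - by exists setT, 0; split=> //; exact: filterT.
  - move=> A B AB [U [C [pU hC]]]; exists U, C; split=> // p t Up /AB; exact: hC.
  - move=> A B [U [C [pU hC]]] [V [D [pV hD]]].
    exists (U `&` V), (Num.max C D); split; first exact: filterI.
    move=> p t [Up Vp] [At|Bt].
      by have [jp h] := hC p t Up At; rewrite le_max h.
    by have [jp h] := hD p t Vp Bt; rewrite le_max h orbT.
exists U => //; exists C => i p t Up ip t01.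
have [|jp] := hC p t Up; first by rewrite /= in_itv.
by rewrite (emb_gen_transition t ip jp).
Qed.

(** The interval [0, 1] is cut into [k] steps so small that each factor
    [1 + E s], with [E s] = - (1/k) times the generator at time s/k, stays
    invertible when [E s] is replaced by any matrix of the same norm; then the
    factors are extended to R^(2K) one by one. *)
Lemma twist_exists : exists P : 'rV[R]_N -> 'M[R]_N,
  [/\ smooth_on setT P, forall x, 0 < \det (P x) &
      forall i p, dom i p -> emb_jac i (phi i p) *m P (emb p) = emb_deform i p 1].
Proof.
have [C hC] := emb_gen_bounded.
pose C1 : R := `|C| + 1; have C10 : 0 < C1 by rewrite ltr_pwDr.
have hC1 i p t : dom i p -> 0 <= t <= 1 -> `|emb_gen i (phi i p) t| <= C1.
  move=> ip t01; apply: le_trans (hC i p t ip t01) _.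
  by rewrite (le_trans (ler_norm C))// lerDl.
pose k := (Num.truncn (N%:R * C1)).+1.
have k0 : 0 < k%:R :> R by rewrite ltr0n.
have kC : N%:R * (C1 / k%:R) < 1.
  rewrite mulrA ltr_pdivrMr// mul1r.
  by have /andP[_] := @truncn_itv R (N%:R * C1) (mulr_ge0 (ler0n _ _) (ltW C10)).
have /choice[c hc] : forall p : M, exists i, dom i p by move=> p; exact: mcover.
pose E (s : nat) p := (- k%:R^-1) *: emb_gen (c p) (phi (c p) p) (s%:R / k%:R).
have EE s i p : dom i p -> E s p = (- k%:R^-1) *: emb_gen i (phi i p) (s%:R / k%:R).
  by move=> ip; rewrite /E (emb_gen_transition _ (hc p) ip).
have sE s : smfun (E s).
  move=> i; have oC := @ccod_open _ _ _ (mchart i).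
  apply: (smooth_on_eq oC _
    (smooth_onZ oC (smooth_on_cst _ (- k%:R^-1 : R)) (@emb_gen_smooth i (s%:R / k%:R)))).
  by move=> x /set_mem ix; rewrite /in_chart (EE s i _ (cinv_cdom ix)) (cinvK ix).
have bE s : (s < k)%N -> forall p, `|E s p| <= C1 / k%:R.
  move=> sk p; rewrite normrZ normrN gtr0_norm ?invr_gt0// mulrC ler_pM2r ?invr_gt0//.
  apply: hC1; first exact: hc.
  by rewrite divr_ge0//= ler_pdivrMr// mul1r ler_nat ltnW.
have e0 : 0 <= C1 / k%:R by rewrite divr_ge0// ltW.
have /choice[G hG] : forall s, exists G : 'rV[R]_N -> 'M[R]_N, (s < k)%N ->
    [/\ smooth_on setT G, forall x, `|G x| <= C1 / k%:R & forall p, G (emb p) = E s p].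
  move=> s; have [sk|_] := boolP (s < k)%N; last by exists (fun=> 0).
  have [G hG] := smooth_extension cM emb_embeds (sE s) e0 (bE s sk).
  by exists G.
exists (step_prod G k); split.
- by apply: step_prod_smooth => s /hG[].
- move=> x; apply: step_prod_det_gt0 => s /hG[_ /(_ x) Gx _].
  by apply: le_lt_trans kC; rewrite ler_wpM2l.
- move=> i p ip; rewrite -(@divff _ k%:R) ?gt_eqF//.
  (* The first s factors carry df to the deformation at time s / k. *)
  suff H s : (s <= k)%N -> emb_jac i (phi i p) *m step_prod G s (emb p) = emb_deform i p (s%:R / k%:R).
    exact: H.
  elim: s => [|s IH] sk; first by rewrite mulmx1 mul0r emb_deform0.
  rewrite /= mulmxA IH ?(ltnW sk)//; have [_ _ ->] := hG s sk.
  rewrite (EE s i p ip) (emb_gen_phi _ ip) deform_step; last exact: emb_deform_unit.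
  by rewrite -natr1 mulrDl mul1r.
Qed.

Theorem emb_pseudo_holomorphic : exists Jt : almostComplex (euclidean R N),
  [/\ positive_acs (standard_orientation R N) Jt,
      @smooth_embedding R n N M (euclidean R N) emb &
      @pseudo_holomorphic R n N M (euclidean R N) J Jt emb].
Proof.
have [P [sP dP PE]] := twist_exists.
have smE := smfun_euclidean emb_smfun.
exists (twisted_acs sP dP); split; first exact: twisted_positive.
  split; last first.
    apply: (compact_embedding cM (@norm_hausdorff _ _) (smfun_continuous emb_smfun)).
    exact: emb_inj.
  split=> // i j p ip _ v w vw; apply/eqP; rewrite -subr_eq0; apply/eqP.
  apply: (@emb_deform_inj i p 0 _ ip); rewrite emb_deform0 -emb_diff// linearB /=.
  apply/eqP; rewrite subr_eq0; apply/eqP; exact: vw.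
split=> // i j p ip _ v.
have tE w : tangent_map i j (emb : M -> euclidean R N) p w = w *m emb_jac i (phi i p).
  exact: emb_diff.
rewrite !tE /= /twisted.
have PJ : emb_jac i (phi i p) *m P (emb p) *m stdJ R K =
    J i p *m (emb_jac i (phi i p) *m P (emb p)).
  by rewrite PE//; exact/deform1_complex/(acs_sqr J ip).
exact: (mulmx_conj v (unit_twist dP (emb p)) PJ).
Qed.
End Assembly.

Theorem theorem1 (R : realType) (m : nat) (hm : (1 <= m)%N)
    (M : smoothManifold R (2 * m)) (hM : compact [set: M])
    (J : almostComplex M) :
  exists (Jt : almostComplex (euclidean R (6 * m)))
         (f : M -> euclidean R (6 * m)),
    [/\ positive_acs (standard_orientation R (6 * m)) Jt,
        smooth_embedding f &
        pseudo_holomorphic J Jt f].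
Proof.
have mK : (2 * m < 3 * m)%N by rewrite ltn_mul2r hm.
have [a [b gab]] := generic_pair_exists J hM mK.
have -> : (6 * m = (3 * m).*2)%N by lia.
have [Jt h] := emb_pseudo_holomorphic hM gab.
by exists Jt, (emb a b).
Qed.
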